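(* There is an injective Lie algebra morphism $\hat\gamma:\mathfrak{krv}\hookrightarrow\mathfrak{krv}_{ell}$.
   Context: Let $\mathfrak{lie}_2$ be the degree-completed free Lie algebra over $\mathbb{Q}$ on $x,y$ inside $\mathrm{Ass}_2=\mathbb{Q}\langle\langle x,y\rangle\rangle$, weight = degree, depth = $y$-degree; write $f=c+f_xx+f_yy$ for $f\in\mathrm{Ass}_2$ with constant term $c$. $C_i=\mathrm{ad}(x)^{i-1}(y)$, $\mathfrak{lie}_C$ the completed free Lie algebra on the $C_i$. $\mathfrak{krv}$: for $a,b\in\mathfrak{lie}_2$ ($a$ without linear $x$-term, $b$ without linear $y$-term) $E_{a,b}$ is the derivation $x\mapsto[x,a]$, $y\mapsto[y,b]$; $\mathfrak{sder}_2$ consists of those with $[x,a]+[y,b]=0$, a Lie algebra under commutator. $\mathrm{tr}:\mathrm{Ass}_2\to\mathfrak{tr}_2$ is the quotient identifying cyclically permuted words; $\mathrm{div}(E_{a,b})=\mathrm{tr}(a_xx+b_yy)$. $\mathfrak{krv}$ is the weight-$\ge3$ part of the Lie subalgebra of $E_{a,b}\in\mathfrak{sder}_2$ with $\mathrm{div}(E_{a,b})=\mathrm{tr}(h(x+y)-h(x)-h(y))$ for some one-variable power series $h$ of degree $\ge2$, with bracket the commutator. $\mathfrak{krv}_{ell}$: for $b\in\mathfrak{lie}_C$ write its depth-$r$ part as $\sum k_{\underline a}C_{a_1}\cdots C_{a_r}$, $B^r=\sum k_{\underline a}u_1^{a_1-1}\cdots u_r^{a_r-1}$, $B_*^r=B^r/(u_1\cdots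 u_r(u_1+\dots+u_r))$. A family $(A^r)$ of rational functions is push-invariant if $A^r(u_0,u_1,\dots,u_{r-1})=A^r(u_1,\dots,u_r)$ with $u_0=-\sum u_i$; its swap is $A^r(v_r,v_{r-1}-v_r,\dots,v_1-v_2)$; a family $(M^r)$ in variables $v_i$ is circ-neutral if $\sum_{i=0}^{r-1}M^r(v_{i+1},\dots,v_r,v_1,\dots,v_i)=0$ for $r>1$. $\mathfrak{krv}_{ell}$ is the space of $b\in\mathfrak{lie}_C$ with $(B_*^r)$ push-invariant and whose swap becomes circ-neutral after adding a family of constants. Its Lie bracket is $\langle b,b'\rangle=D_{b,a}(b')-D_{b',a'}(b)$, where $D_{b,a}$ is the derivation $x\mapsto b$, $y\mapsto a$ and $a$ is the unique element of $\mathfrak{lie}_C$ with $D_{b,a}([x,y])=0$. *)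

(* Defs.v *)
From HB Require Import structures.
From mathcomp Require Import all_boot all_algebra.
From mathcomp Require Import fraction.
From mathcomp Require Import mpoly.
Set Implicit Arguments. Unset Strict Implicit. Unset Printing Implicit Defensive.
Import GRing.Theory.
Local Open Scope ring_scope.

(* A word is a list of letters; false = x, true = y. *)
Definition word := seq bool.
Definition series := word -> rat.

Definition szero : series := fun _ => 0.
Definition sadd (f g : series) : series := fun w => f w + g w.
Definition sopp (f : series) : series := fun w => - f w.
Definition ssub (f g : series) : series := sadd f (sopp g).
Definition sscale (c : rat) (f : series) : series := fun w => c * f w.
Definition smul (f g : series) : series :=
  fun w => \sum_(i < (size w).+1) f (take i w) * g (drop i w).
Definition sbr (f g : series) : series := ssub (smul f g) (smul g f).
Definition smono (v : word) : series := fun u => if u == v then 1 else 0.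
Definition sX : series := smono [:: false].
Definition sY : series := smono [:: true].
Definition sOne : series := smono [::].
Definition hcomp (n : nat) (f : series) : series :=
  fun w => if size w == n then f w else 0.

Inductive lie_span (G : series -> Prop) : series -> Prop :=
| ls_gen g : G g -> lie_span G g
| ls_add f g : lie_span G f -> lie_span G g -> lie_span G (sadd f g)
| ls_scale c f : lie_span G f -> lie_span G (sscale c f)
| ls_br f g : lie_span G f -> lie_span G g -> lie_span G (sbr f g).

(* lie_2: degree-completed free Lie algebra on x,y inside Ass_2 *)
Definition lie_2 (f : series) : Prop :=
  forall n, lie_span (fun g => g = sX \/ g = sY) (hcomp n f).

Definition sC (i : nat) : series := iter i.-1 (sbr sX) sY.

Definition lie_C (f : series) : Prop :=
  forall n, lie_span (fun g => exists i, (0 < i)%N /\ g = sC i) (hcomp n f).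

Fixpoint words (k : nat) : seq word :=
  if k is k'.+1 then [seq b :: w | b <- [:: false; true], w <- words k']
  else [:: [::]].

Definition der_word (fx fy : series) (w : word) : series :=
  fun u => \sum_(i < size w)
     smul (smul (smono (take i w)) (if nth false w i then fy else fx))
          (smono (drop i.+1 w)) u.

(* the continuous derivation x |-> fx, y |-> fy applied to a series; this is
   the correct (convergent) formula whenever fx, fy have no constant term,
   which is the case for all uses below *)
Definition der (fx fy : series) (f : series) : series :=
  fun u => \sum_(k < (size u).+1) \sum_(w <- words k) f w * der_word fx fy w u.

(* an element E_{a,b} is represented by the pair (a,b) *)
Definition Eop (e : series * series) : series -> series :=
  der (sbr sX e.1) (sbr sY e.2).

Definition padd (e e' : series * series) := (sadd e.1 e'.1, sadd e.2 e'.2).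
Definition pscale (c : rat) (e : series * series) := (sscale c e.1, sscale c e.2).

(* f_x x and f_y y parts (words ending in x, resp. in y) *)
Definition xpart (f : series) : series :=
  fun w => if (0 < size w)%N && ~~ last true w then f w else 0.
Definition ypart (f : series) : series :=
  fun w => if (0 < size w)%N && last false w then f w else 0.

(* equality in the trace space tr_2 (cyclic words) *)
Definition rots (w : word) : seq word := undup [seq rot i w | i <- iota 0 (size w).+1].
Definition tr_eq (f g : series) : Prop :=
  forall w, \sum_(u <- rots w) (f u - g u) = 0.

(* h(x+y) - h(x) - h(y) for h = sum_{n>=2} h_n t^n *)
Definition hterm (h : nat -> rat) : series :=
  fun w => if (2 <= size w)%N then
             h (size w) * (1 - (if all negb w then 1 else 0)
                             - (if all id w then 1 else 0))
           else 0.

Definition sder2 (e : series * series) : Prop :=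
  lie_2 e.1 /\ lie_2 e.2 /\ e.1 [:: false] = 0 /\ e.2 [:: true] = 0 /\
  sadd (sbr sX e.1) (sbr sY e.2) = szero.

Definition krv (e : series * series) : Prop :=
  sder2 e /\
  (exists h : nat -> rat, tr_eq (sadd (xpart e.1) (ypart e.2)) (hterm h)) /\
  (forall w, (size w < 3)%N -> e.1 w = 0 /\ e.2 w = 0).

Fixpoint comps_aux (m n : nat) : seq (seq nat) :=
  match m with
  | 0 => if n == 0%N then [:: [::]] else [::]
  | m'.+1 => if n == 0%N then [:: [::]] else
      flatten [seq [seq i :: s | s <- comps_aux m' (n - i)] | i <- iota 1 n]
  end.
Definition comps (n : nat) : seq (seq nat) := comps_aux n n.

Definition Cprod (a : seq nat) : series := foldr (fun i acc => smul (sC i) acc) sOne a.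

Definition Cexp (k : seq nat -> rat) (b : series) : Prop :=
  forall w, b w = \sum_(a <- comps (size w)) k a * Cprod a w.

Definition mvar (r j : nat) : {mpoly rat[r]} :=
  oapp (fun i : 'I_r => 'X_i) 0 (insub j).

(* weight-n part of B^r (variables u_1..u_r are 'X_0..'X_(r-1)) *)
Definition Bpoly (k : seq nat -> rat) (r n : nat) : {mpoly rat[r]} :=
  \sum_(a <- comps n | size a == r) k a *: \prod_(i < r) 'X_i ^+ (nth 0%N a i).-1.
Definition Dpoly (r : nat) : {mpoly rat[r]} :=
  (\prod_(i < r) 'X_i) * (\sum_(i < r) 'X_i).

Definition push_t (r : nat) : r.-tuple {mpoly rat[r]} :=
  [tuple if (i : nat) == 0%N then - \sum_(j < r) 'X_j else mvar r (i : nat).-1 | i < r].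
Definition swap_t (r : nat) : r.-tuple {mpoly rat[r]} :=
  [tuple if (i : nat) == 0%N then mvar r r.-1
         else mvar r (r.-1 - i) - mvar r (r - i) | i < r].
Definition circ_t (r i : nat) : r.-tuple {mpoly rat[r]} :=
  [tuple mvar r (((j : nat) + i) %% r) | j < r].

Definition frac (r : nat) (p : {mpoly rat[r]}) : {fraction {mpoly rat[r]}} :=
  tofrac p.

Definition push_invariant (k : seq nat -> rat) : Prop :=
  forall r n, (0 < r)%N ->
    frac (Bpoly k r n \mPo push_t r) / frac (Dpoly r \mPo push_t r)
    = frac (Bpoly k r n) / frac (Dpoly r).

(* swap of B_star becomes circ-neutral after adding a family of constants c_r
   (a constant lives in the degree-0 component, i.e. weight n = 2r+1) *)
Definition swap_circ_neutral_mod_const (k : seq nat -> rat) : Prop :=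
  exists c : nat -> rat, forall r n, (1 < r)%N ->
    \sum_(i < r)
      (frac ((Bpoly k r n \mPo swap_t r) \mPo circ_t r i)
         / frac ((Dpoly r \mPo swap_t r) \mPo circ_t r i)
       + frac ((if n == (2 * r).+1 then c r else 0)%:MP)) = 0.

Definition krv_ell (b : series) : Prop :=
  lie_C b /\
  exists k, Cexp k b /\ push_invariant k /\ swap_circ_neutral_mod_const k.

Definition assoc_a (b a : series) : Prop :=
  lie_C a /\ der b a (sbr sX sY) = szero.

Definition ell_bracket_is (b b' c : series) : Prop :=
  forall a a', assoc_a b a -> assoc_a b' a' ->
    c = ssub (der b a b') (der b' a' b).

(* Main.v *)
From HB Require Import structures.
From mathcomp Require Import all_boot all_algebra.
From mathcomp Require Import fraction mpoly.
From mathcomp Require boolp.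
From mathcomp Require Import zify ring lra.
Require Import Defs.
Set Implicit Arguments. Unset Strict Implicit. Unset Printing Implicit Defensive.
Import GRing.Theory Num.Theory.
Local Open Scope ring_scope.

(* Let e = exp(x), K(t) = t / (exp(t) - 1), p = - K(ad x)(y) and q = - e p e^-1, so that
   p + q = [x, y].  A special derivation x -> [x, a], y -> [y, b] is transported to the
   derivation D with p -> [p, a(p,q)], q -> [q, b(p,q)] and e -> e a(p,q) - b(p,q) e;
   it kills [x, y], and the morphism sends (a, b) to D x.  It is injective because p and q
   are free.  The vanishing of [D x, y] + [x, D y] is push-invariance.  Computed in the
   coordinates (p, e), whose Fox Jacobian has trivial logarithmic trace, the divergence of
   D is the trace of div(a, b) evaluated at (p, q); as h is odd and q is conjugate to - p,
   only tr h([x, y]) survives.  Since D y is determined by D x, this divergence is a cyclic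
   sum in the generating polynomials of D x, and it amounts to circ-neutrality of the swap
   up to the constants h_r. *)

(** * The algebra of noncommutative power series *)

(** The series p and q do not generate x, so prescribing D on them is not enough; the value on e
    closes the gap. Since D e = J(ad x)(D x) e with J = 1/K, it amounts to a value of D x; then D p
    fixes D y, while D q follows from q e = - e p. That h is odd comes from depth one: [x, a] +
    [y, b] = 0 kills the depth-one part of a and equates the coefficients of b on x^m y and y x^m,
    whereas a Lie series of even degree changes sign when its words are reversed. With the word x^e0
    y ... y x^er encoded as z_0^e0 ... z_r^er and u_i = z_(i-1) - z_i, the denominator of B_* is, up
    to sign, the product of the cyclic differences of z_0, ..., z_r. The push rotates these r + 1
    variables. In the circ sum z_0 = 0 stays and the r others rotate: partial fractions in two
    neighbouring variables and summation by parts give the cyclic sum that the divergence defines.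
    The constants sit in weight 2 r + 1 because [x, y]^r has depth r and weight 2 r, and the
    divergence has weight one less than D x. *)

Lemma sext (f g : series) : f =1 g -> f = g.
Proof. exact: boolp.funext. Qed.

(** The algebraic hierarchy asks for an equality test and a choice operator, which a type of
    functions has only classically. *)
HB.instance Definition _ := boolp.gen_eqMixin series.
HB.instance Definition _ := boolp.gen_choiceMixin series.

Lemma series_addA : associative sadd.
Proof. by move=> f g h; apply: sext => w; rewrite /sadd addrA. Qed.
Lemma series_addC : commutative sadd.
Proof. by move=> f g; apply: sext => w; rewrite /sadd addrC. Qed.
Lemma series_add0 : left_id szero sadd.
Proof. by move=> f; apply: sext => w; rewrite /sadd add0r. Qed.
Lemma series_addN : left_inverse szero sopp sadd.
Proof. by move=> f; apply: sext => w; rewrite /sadd /sopp addNr. Qed.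

HB.instance Definition _ := GRing.isZmodule.Build series
  series_addA series_addC series_add0 series_addN.

(** Left quotient by a letter, a left-handed Fox derivative. With the constant term it determines a
    series, so identities on products go by induction on words. *)
Definition lq (b : bool) (f : series) : series := fun w => f (b :: w).

Lemma smul_nil f g : smul f g [::] = f [::] * g [::].
Proof. by rewrite /smul /= big_ord1. Qed.

Lemma smul_cons f g b w :
  smul f g (b :: w) = f [::] * g (b :: w) + smul (lq b f) g w.
Proof. by rewrite /smul /= big_ord_recl. Qed.

Lemma smulDl : left_distributive smul sadd.
Proof.
move=> f g h; apply: sext => w; rewrite /smul /sadd -big_split /=.
by apply: eq_bigr => i _; rewrite mulrDl.
Qed.

Lemma smulDr : right_distributive smul sadd.
Proof.
move=> f g h; apply: sext => w; rewrite /smul /sadd -big_split /=.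
by apply: eq_bigr => i _; rewrite mulrDr.
Qed.

Lemma smulZl c f g : smul (sscale c f) g = sscale c (smul f g).
Proof.
apply: sext => w; rewrite /smul /sscale mulr_sumr.
by apply: eq_bigr => i _; rewrite mulrA.
Qed.

Lemma smulZr c f g : smul f (sscale c g) = sscale c (smul f g).
Proof.
apply: sext => w; rewrite /smul /sscale mulr_sumr.
by apply: eq_bigr => i _; rewrite mulrCA.
Qed.

Lemma lq_smul b f g : lq b (smul f g) = sadd (sscale (f [::]) (lq b g)) (smul (lq b f) g).
Proof. by apply: sext => w; rewrite /lq smul_cons. Qed.

Lemma smulA : associative smul.
Proof.
move=> f g h; apply: sext => w; elim: w f g h => [|b w IH] f g h.
  by rewrite !smul_nil mulrA.
rewrite !smul_cons lq_smul smulDl smulZl /sadd /sscale IH smul_nil.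
by rewrite mulrDr addrA mulrA.
Qed.

Lemma smul1l : left_id sOne smul.
Proof.
move=> f; apply: sext; case=> [|b w]; first by rewrite smul_nil /sOne /smono eqxx mul1r.
rewrite smul_cons {1}/sOne /smono eqxx mul1r /smul big1 ?addr0 // => i _.
by rewrite /lq /sOne /smono mul0r.
Qed.

Lemma smul1r : right_id sOne smul.
Proof.
move=> f; apply: sext => w; rewrite /smul big_ord_recr /= take_size drop_size.
rewrite {2}/sOne /smono eqxx mulr1 big1 ?add0r // => i _.
rewrite /sOne /smono; case: eqP => [/(congr1 size)/=|_]; last by rewrite mulr0.
by rewrite size_drop /= => /eqP; rewrite subn_eq0 leqNgt ltn_ord.
Qed.

Lemma sOne_neq0 : sOne != 0 :> series.
Proof.
apply/eqP => /(congr1 (fun f => f [::])); rewrite /sOne /smono eqxx => /eqP.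
by rewrite oner_eq0.
Qed.

HB.instance Definition _ := GRing.Zmodule_isNzRing.Build series
  smulA smul1l smul1r smulDl smulDr sOne_neq0.

Lemma sscaleA c d f : sscale c (sscale d f) = sscale (c * d) f.
Proof. by apply: sext => w; rewrite /sscale mulrA. Qed.
Lemma sscale1 : left_id 1 sscale.
Proof. by move=> f; apply: sext => w; rewrite /sscale mul1r. Qed.
Lemma sscaleDr : right_distributive sscale sadd.
Proof. by move=> c f g; apply: sext => w; rewrite /sscale /sadd mulrDr. Qed.
Lemma sscaleDl f : {morph sscale^~ f : c d / c + d >-> sadd c d}.
Proof. by move=> c d; apply: sext => w; rewrite /sscale /sadd mulrDl. Qed.

HB.instance Definition _ := GRing.Zmodule_isLmodule.Build rat series
  sscaleA sscale1 sscaleDr sscaleDl.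

HB.instance Definition _ := GRing.Lmodule_isLalgebra.Build rat series
  (fun c f g => esym (smulZl c f g)).
HB.instance Definition _ := GRing.Lalgebra_isAlgebra.Build rat series
  (fun c f g => esym (smulZr c f g)).

Lemma saddE f g : sadd f g = f + g. Proof. by []. Qed.
Lemma smulE f g : smul f g = f * g. Proof. by []. Qed.
Lemma szeroE : szero = 0. Proof. by []. Qed.
Lemma sOneE : sOne = 1. Proof. by []. Qed.
Lemma sscaleE c f : sscale c f = c *: f. Proof. by []. Qed.
Lemma sbrE f g : sbr f g = f * g - g * f. Proof. by []. Qed.

Lemma add_at (f g : series) w : (f + g) w = f w + g w. Proof. by []. Qed.
Lemma opp_at (f : series) w : (- f) w = - f w. Proof. by []. Qed.
Lemma sub_at (f g : series) w : (f - g) w = f w - g w. Proof. by []. Qed.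
Lemma scale_at c (f : series) w : (c *: f) w = c * f w. Proof. by []. Qed.
Lemma zero_at w : (0 : series) w = 0. Proof. by []. Qed.
Lemma one_at w : (1 : series) w = (w == [::])%:R.
Proof. by rewrite -sOneE /sOne /smono; case: eqP. Qed.
Lemma mul_at (f g : series) w :
  (f * g) w = \sum_(i < (size w).+1) f (take i w) * g (drop i w).
Proof. by []. Qed.
Lemma mul_nil (f g : series) : (f * g) [::] = f [::] * g [::].
Proof. exact: smul_nil. Qed.
Lemma sum_at I (r : seq I) (P : pred I) (F : I -> series) w :
  (\sum_(i <- r | P i) F i) w = \sum_(i <- r | P i) F i w.
Proof. by elim/big_rec2: _ => // i x y _ <-. Qed.
Definition at_ := (add_at, opp_at, scale_at, zero_at, sum_at).

Lemma smonoE v w : smono v w = (w == v)%:R.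
Proof. by rewrite /smono; case: eqP. Qed.

Notation letter b := (smono [:: b]).

Lemma lq_mul b (f g : series) : lq b (f * g) = f [::] *: lq b g + lq b f * g.
Proof. exact: lq_smul. Qed.

Lemma lq_letter b c : lq b (letter c) = (b == c)%:R.
Proof.
apply: sext => w; rewrite /lq smonoE eqseq_cons.
by case: eqP => _ /=; rewrite ?mulr1n ?mulr0n ?one_at.
Qed.

Lemma letter_mul b (f : series) w :
  (letter b * f) w = if w is c :: w' then (c == b)%:R * f w' else 0.
Proof.
case: w => [|c w]; first by rewrite mul_nil smonoE mul0r.
rewrite -[LHS]/(lq c (letter b * f) w) lq_mul smonoE scale0r add0r lq_letter.
by case: eqP => _ /=; rewrite ?mulr1n ?mulr0n ?mul1r ?mul0r.
Qed.

Lemma mul_letter b (f : series) w c :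
  (f * letter b) (rcons w c) = (c == b)%:R * f w.
Proof.
elim: w f => [|d w IH] f /=.
  rewrite -[LHS]/(lq c _ _) lq_mul add_at scale_at lq_letter mul_nil smonoE.
  by rewrite mulr0 addr0 mulrC; case: eqP => _; rewrite ?mulr1n ?mulr0n ?one_at.
rewrite -[LHS]/(lq d _ _) lq_mul add_at scale_at lq_letter IH /lq.
case: eqP => _; rewrite ?mulr1n ?mulr0n ?one_at ?zero_at ?mulr0 ?add0r //.
by case: w {IH} => [|? ?] /=; rewrite mulr0 add0r.
Qed.

Lemma mul_letter_nil b (f : series) : (f * letter b) [::] = 0.
Proof. by rewrite mul_nil smonoE mulr0. Qed.

Lemma smono_cons b w : smono (b :: w) = letter b * smono w.
Proof.
apply: sext; case=> [|c v]; rewrite letter_mul /= !smonoE // eqseq_cons.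
by rewrite -natrM mulnb.
Qed.

Lemma smono_nil : smono [::] = 1. Proof. by []. Qed.

Lemma smono_cat u v : smono (u ++ v) = smono u * smono v.
Proof.
by elim: u => [|b u IH]; rewrite ?mul1r //= smono_cons IH mulrA -smono_cons.
Qed.

Lemma smono_rcons w b : smono (rcons w b) = smono w * letter b.
Proof. by rewrite -cats1 smono_cat. Qed.

(** * Order and continuity *)

Definition vord n (f : series) := forall w, (size w < n)%N -> f w = 0.

Lemma vordD n f g : vord n f -> vord n g -> vord n (f + g).
Proof. by move=> Hf Hg w Hw; rewrite add_at Hf ?Hg ?addr0. Qed.
Lemma vordN n f : vord n f -> vord n (- f).
Proof. by move=> Hf w Hw; rewrite opp_at Hf ?oppr0. Qed.
Lemma vordB n f g : vord n f -> vord n g -> vord n (f - g).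
Proof. by move=> Hf Hg; apply/vordD/vordN. Qed.
Lemma vordZ n c f : vord n f -> vord n (c *: f).
Proof. by move=> Hf w Hw; rewrite scale_at Hf ?mulr0. Qed.
Lemma vord_le m n f : (m <= n)%N -> vord n f -> vord m f.
Proof. by move=> Hmn Hf w Hw; apply/Hf/(leq_trans Hw). Qed.
Lemma vord_any f : vord 0 f. Proof. by []. Qed.

Lemma vordM m n f g : vord m f -> vord n g -> vord (m + n) (f * g).
Proof.
move=> Hf Hg w Hw; rewrite mul_at big1 // => i _.
have [Hi|Hi] := ltnP (size (take i w)) m; first by rewrite Hf ?mul0r.
rewrite [g _]Hg ?mulr0 // size_drop; move: Hi; rewrite size_take.
by case: (ltnP i (size w)) => *; lia.
Qed.

Lemma vordMl n f g : vord n g -> vord n (f * g).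
Proof. exact: (@vordM 0). Qed.
Lemma vordMr n f g : vord n f -> vord n (f * g).
Proof. by rewrite -{2}[n]addn0 => Hf; apply: vordM. Qed.

Lemma vord1 (f : series) : f [::] = 0 -> vord 1 f.
Proof. by move=> H [|//]. Qed.

Lemma vord_smono n w : (n <= size w)%N -> vord n (smono w).
Proof. by move=> H u Hu; rewrite smonoE; case: eqP => // E; rewrite -E in H; lia. Qed.

Lemma vord_zero f : (forall n, vord n f) -> f = 0.
Proof. by move=> H; apply: sext => w; apply: (H (size w).+1). Qed.

(** Linear and continuous for the filtration by order. Such a map is determined by its values on
    words ([cont_ext]), which reduces multiplicativity, the Leibniz rule and invariance of the trace
    to monomials. *)
Definition cont (F : series -> series) :=
  (forall c f g, F (c *: f + g) = c *: F f + F g) /\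
  (forall n, exists m, forall f, vord m f -> vord n (F f)).

Lemma cont_add F : cont F -> {morph F : f g / f + g}.
Proof. by case=> H _ f g; have := H 1 f g; rewrite !scale1r. Qed.
Lemma cont0 F : cont F -> F 0 = 0.
Proof.
move=> HF; have := cont_add HF 0 0; rewrite addr0.
by move=> /eqP; rewrite -subr_eq subrr => /eqP.
Qed.
Lemma cont_scale F : cont F -> forall c f, F (c *: f) = c *: F f.
Proof. by move=> HF c f; have := HF.1 c f 0; rewrite !addr0 (cont0 HF) addr0. Qed.
Lemma cont_opp F : cont F -> {morph F : f / - f}.
Proof. by move=> HF f; rewrite -scaleN1r (cont_scale HF) scaleN1r. Qed.
Lemma cont_sub F : cont F -> {morph F : f g / f - g}.
Proof. by move=> HF f g; rewrite (cont_add HF) (cont_opp HF). Qed.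
Lemma cont_sum F : cont F -> forall I (r : seq I) (P : pred I) (G : I -> series),
  F (\sum_(i <- r | P i) G i) = \sum_(i <- r | P i) F (G i).
Proof.
by move=> HF I r P G; apply: (big_morph F (cont_add HF) (cont0 HF)).
Qed.

Lemma cont_id : cont id.
Proof. by split=> // n; exists n. Qed.
Lemma cont_comp F G : cont F -> cont G -> cont (fun f => F (G f)).
Proof.
move=> HF HG; split=> [c f g|n]; first by rewrite HG.1 HF.1.
by have [m Hm] := HF.2 n; have [k Hk] := HG.2 m; exists k => f /Hk/Hm.
Qed.
Lemma contD F G : cont F -> cont G -> cont (fun f => F f + G f).
Proof.
move=> HF HG; split=> [c f g|n].
  by rewrite HG.1 HF.1 scalerDr addrACA.
have [m Hm] := HF.2 n; have [k Hk] := HG.2 n; exists (maxn m k) => f Hf.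
apply: vordD; [apply: Hm|apply: Hk]; apply: vord_le Hf; lia.
Qed.
Lemma contN F : cont F -> cont (fun f => - F f).
Proof.
move=> HF; split=> [c f g|n]; first by rewrite HF.1 opprD scalerN.
by have [m Hm] := HF.2 n; exists m => f /Hm/vordN.
Qed.
Lemma contB F G : cont F -> cont G -> cont (fun f => F f - G f).
Proof. by move=> HF HG; apply/contD/contN. Qed.
Lemma cont_mull g : cont (fun f => g * f).
Proof.
split=> [c f h|n]; first by rewrite mulrDr scalerAr.
by exists n => f; apply: vordMl.
Qed.
Lemma cont_mulr g : cont (fun f => f * g).
Proof.
split=> [c f h|n]; first by rewrite mulrDl scalerAl.
by exists n => f; apply: vordMr.
Qed.
Lemma cont_cmull F g : cont F -> cont (fun f => g * F f).
Proof. exact: (cont_comp (cont_mull g)). Qed.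
Lemma cont_cmulr F g : cont F -> cont (fun f => F f * g).
Proof. exact: (cont_comp (cont_mulr g)). Qed.

Lemma size_words k w : w \in words k -> size w = k.
Proof.
elim: k w => [|k IH] w /=; first by rewrite inE => /eqP->.
by rewrite cats0 mem_cat => /orP[] /mapP[v /IH<- ->].
Qed.

Lemma big_words0 (V : nmodType) (F : word -> V) : \sum_(w <- words 0) F w = F [::].
Proof. by rewrite /= big_seq1. Qed.

Lemma big_wordsS (V : nmodType) k (F : word -> V) :
  \sum_(w <- words k.+1) F w = \sum_(w <- words k) (F (false :: w) + F (true :: w)).
Proof. by rewrite /= cats0 big_cat !big_map big_split. Qed.

Lemma big_wordsSr (V : nmodType) k (F : word -> V) :
  \sum_(w <- words k.+1) F w = \sum_(w <- words k) (F (rcons w false) + F (rcons w true)).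
Proof.
elim: k F => [|k IH] F; first by rewrite big_wordsS !big_words0.
rewrite big_wordsS (IH (fun w => F (false :: w) + F (true :: w))).
by rewrite [RHS]big_wordsS; apply: eq_bigr => w _; rewrite addrACA.
Qed.

Lemma big_words_at (V : nmodType) k (F : word -> V) u :
  \sum_(w <- words k | w == u) F w = if size u == k then F u else 0.
Proof.
elim: k F u => [|k IH] F u; first by rewrite /= big_mkcond big_seq1 eq_sym; case: u.
rewrite big_mkcond big_wordsS; case: u => [|b u] /=.
  by rewrite big1 // => w _; rewrite /= addr0.
rewrite eqSS -(IH (fun v => F (b :: v))) [RHS]big_mkcond; apply: eq_bigr => w _ /=.
by rewrite !eqseq_cons; case: b => /=; rewrite ?add0r ?addr0.
Qed.

Definition trunc n (f : series) : series :=
  \sum_(k < n) \sum_(w <- words k) f w *: smono w.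

Lemma truncE n f w : trunc n f w = if (size w < n)%N then f w else 0.
Proof.
have H k : (\sum_(v <- words k) f v *: smono v : series) w =
           if size w == k then f w else 0.
  rewrite sum_at -(big_words_at k f w) [RHS]big_mkcond.
  apply: eq_bigr => v _; rewrite scale_at smonoE eq_sym.
  by case: eqP => // _; rewrite ?mulr1 ?mulr0.
rewrite /trunc sum_at; under eq_bigr => k _ do rewrite H.
case: ltnP => Hw; last by rewrite big1 // => k _; case: eqP => // E; have := ltn_ord k; lia.
rewrite (bigD1 (Ordinal Hw)) //= eqxx big1 ?addr0 // => k /eqP Hk.
by case: eqP => // E; case: Hk; apply: val_inj.
Qed.

Lemma vord_trunc n f : vord n (f - trunc n f).
Proof. by move=> w Hw; rewrite sub_at truncE Hw subrr. Qed.

Lemma cont_trunc F : cont F -> forall n, exists m, forall k, (m <= k)%N -> forall f w,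
  (size w < n)%N -> F f w = \sum_(l < k) \sum_(v <- words l) f v * F (smono v) w.
Proof.
move=> HF n; have [m Hm] := HF.2 n; exists m => k Hk f w Hw.
have := Hm _ (vord_le Hk (@vord_trunc k f)) w Hw.
rewrite (cont_sub HF) sub_at => /eqP; rewrite subr_eq0 => /eqP->.
rewrite (cont_sum HF) sum_at; apply: eq_bigr => l _.
rewrite (cont_sum HF) sum_at; apply: eq_bigr => v _.
by rewrite (cont_scale HF).
Qed.

Lemma cont_ext F G : cont F -> cont G ->
  (forall w, F (smono w) = G (smono w)) -> F =1 G.
Proof.
move=> HF HG H f; apply: sext => w.
have [m Hm] := cont_trunc HF (size w).+1; have [k Hk] := cont_trunc HG (size w).+1.
rewrite (Hm (maxn m k)) ?leq_maxl // (Hk (maxn m k)) ?leq_maxr //.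
by apply: eq_bigr => l _; apply: eq_bigr => v _; rewrite H.
Qed.

(** * Extension from words, substitution and derivations *)

(** Stronger than continuity: the order never drops. This lets a map pass through convergent sums in
    [ssum_cont]. *)
Definition slocal (F : series -> series) := forall n f, vord n f -> vord n (F f).

(** Cutting at the length of [u] loses nothing once [G w] has order at least the length of [w]. Both
    [subst] and [der] have this form. *)
Definition ext (G : word -> series) (f : series) : series :=
  fun u => \sum_(k < (size u).+1) \sum_(w <- words k) f w * G w u.

Section Ext.
Variable G : word -> series.
Hypothesis ordG : forall w, vord (size w) (G w).

Lemma extE N f u : (size u < N)%N ->
  ext G f u = \sum_(k < N) \sum_(w <- words k) f w * G w u.
Proof.
move=> HN; rewrite /ext (big_ord_widen N (fun k => \sum_(w <- words k) f w * G w u)) //.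
rewrite [LHS]big_mkcond; apply: eq_bigr => k _; case: ltnP => // Hk.
rewrite big_seq big1 // => w /size_words Hw.
by rewrite ordG ?mulr0 // Hw.
Qed.

Lemma slocal_ext : slocal (ext G).
Proof.
move=> n f Hf u Hu; rewrite /ext big1 // => k _.
rewrite big_seq big1 // => w /size_words Hw; rewrite Hf ?mul0r //.
by apply: leq_ltn_trans Hu; rewrite Hw -ltnS ltn_ord.
Qed.

Lemma cont_extend : cont (ext G).
Proof.
split=> [c f g|n]; last by exists n; apply: slocal_ext.
apply: sext => u; rewrite /ext !at_ mulr_sumr -big_split; apply: eq_bigr => k _.
rewrite mulr_sumr -big_split; apply: eq_bigr => w _ /=.
by rewrite !at_ mulrDl mulrA.
Qed.

Lemma ext_smono w : ext G (smono w) = G w.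
Proof.
apply: sext => u; rewrite (@extE (maxn (size u) (size w)).+1) ?ltnS ?leq_maxl //.
have Hw : (size w < (maxn (size u) (size w)).+1)%N by rewrite ltnS leq_maxr.
have H k : \sum_(v <- words k) smono w v * G v u = if size w == k then G w u else 0.
  rewrite -(big_words_at k (fun v => G v u) w) [RHS]big_mkcond.
  by apply: eq_bigr => v _; rewrite smonoE; case: eqP; rewrite ?mul1r ?mul0r.
under eq_bigr => k _ do rewrite H.
rewrite (bigD1 (Ordinal Hw)) //= eqxx big1 ?addr0 // => k /eqP Hk.
by case: eqP => // E; case: Hk; apply: val_inj.
Qed.
End Ext.

Fixpoint wprod (p q : series) (w : word) : series :=
  if w is b :: w' then (if b then q else p) * wprod p q w' else 1.

Definition subst (p q : series) : series -> series := ext (wprod p q).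

Section Subst.
Variables p q : series.
Hypotheses (p0 : p [::] = 0) (q0 : q [::] = 0).

Lemma ord_wprod w : vord (size w) (wprod p q w).
Proof.
elim: w => [|b w IH] //=; rewrite -add1n; apply: vordM => //.
by apply: vord1; case: b.
Qed.

Lemma cont_subst : cont (subst p q).
Proof. exact: cont_extend. Qed.
Lemma slocal_subst : slocal (subst p q).
Proof. exact: slocal_ext. Qed.
Lemma subst_smono w : subst p q (smono w) = wprod p q w.
Proof. exact: (ext_smono ord_wprod). Qed.

Lemma wprod_cat u v : wprod p q (u ++ v) = wprod p q u * wprod p q v.
Proof. by elim: u => [|b u IH] /=; rewrite ?mul1r // IH mulrA. Qed.

Lemma substM f g : subst p q (f * g) = subst p q f * subst p q g.
Proof.
move: f; apply: cont_ext => [||u].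
- exact: (cont_comp cont_subst (cont_mulr g)).
- exact/cont_cmulr/cont_subst.
move: g; apply: cont_ext => [||v].
- exact: (cont_comp cont_subst (cont_mull _)).
- exact/cont_cmull/cont_subst.
by rewrite -smono_cat !subst_smono wprod_cat.
Qed.

Lemma subst1 : subst p q 1 = 1.
Proof. by rewrite -[1]/(smono [::]) subst_smono. Qed.
Lemma substX : subst p q sX = p.
Proof. by rewrite subst_smono /= mulr1. Qed.
Lemma substY : subst p q sY = q.
Proof. by rewrite subst_smono /= mulr1. Qed.
Lemma subst_exp f n : subst p q (f ^+ n) = subst p q f ^+ n.
Proof. by elim: n => [|n IH]; rewrite ?subst1 // !exprS substM IH. Qed.
Lemma subst_nil f : subst p q f [::] = f [::].
Proof. by rewrite /subst /ext big_ord1 big_words0 /= one_at mulr1. Qed.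
End Subst.

Lemma ord_der_word (fx fy : series) : fx [::] = 0 -> fy [::] = 0 ->
  forall w, vord (size w) (der_word fx fy w).
Proof.
move=> fx0 fy0 w u Hu; rewrite /der_word big1 // => i _; move: u Hu.
apply: (@vord_le _ ((size (take i w) + 1) + size (drop i.+1 w))%N).
  by rewrite size_take size_drop ltn_ord; have := ltn_ord i; lia.
apply: vordM; last exact: vord_smono.
by apply: vordM; [apply: vord_smono|apply: vord1; case: nth].
Qed.

Lemma der_word_cons fx fy b w :
  der_word fx fy (b :: w) = (if b then fy else fx) * smono w + letter b * der_word fx fy w.
Proof.
apply: sext => u; rewrite {1}/der_word /= big_ord_recl add_at /= ?take0 ?drop0.
rewrite !smulE smono_nil mul1r; congr (_ + _).
have -> : der_word fx fy w = \sum_(i < size w)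
   (smono (take i w) * (if nth false w i then fy else fx) * smono (drop i.+1 w)).
  by apply: sext => v; rewrite sum_at.
rewrite mulr_sumr sum_at; apply: eq_bigr => i _.
by rewrite !smulE (smono_cons b (take i w)) !mulrA.
Qed.

Section Derivation.
Variables fx fy : series.
Hypotheses (fx0 : fx [::] = 0) (fy0 : fy [::] = 0).

Lemma cont_der : cont (der fx fy).
Proof. exact: cont_extend. Qed.
Lemma slocal_der : slocal (der fx fy).
Proof. exact: slocal_ext. Qed.
Lemma der_smono w : der fx fy (smono w) = der_word fx fy w.
Proof. exact: (ext_smono (ord_der_word fx0 fy0)). Qed.

Lemma der_word_nil : der_word fx fy [::] = 0.
Proof. by apply: sext => u; rewrite /der_word big_ord0. Qed.

Lemma der_word_cat u v :
  der_word fx fy (u ++ v) = der_word fx fy u * smono v + smono u * der_word fx fy v.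
Proof.
elim: u => [|b u IH] /=; first by rewrite der_word_nil mul0r add0r mul1r.
rewrite !der_word_cons IH smono_cat (smono_cons b u) mulrDl mulrDr !mulrA.
by rewrite !addrA.
Qed.

Lemma derM f g : der fx fy (f * g) = der fx fy f * g + f * der fx fy g.
Proof.
move: f; apply: cont_ext => [||u].
- exact: (cont_comp cont_der (cont_mulr g)).
- by apply: contD; [exact/cont_cmulr/cont_der|exact: cont_mulr].
move: g; apply: cont_ext => [||v].
- exact: (cont_comp cont_der (cont_mull _)).
- by apply: contD; [exact/cont_mull|exact/cont_cmull/cont_der].
by rewrite -smono_cat !der_smono der_word_cat.
Qed.

Lemma der1 : der fx fy 1 = 0.
Proof. by rewrite -[1]/(smono [::]) der_smono der_word_nil. Qed.
Lemma derX : der fx fy sX = fx.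
Proof. by rewrite der_smono der_word_cons der_word_nil mulr0 addr0 mulr1. Qed.
Lemma derY : der fx fy sY = fy.
Proof. by rewrite der_smono der_word_cons der_word_nil mulr0 addr0 mulr1. Qed.
End Derivation.

Lemma Leibniz_one (F : series -> series) :
  (forall f g, F (f * g) = F f * g + f * F g) -> F 1 = 0.
Proof.
move=> H; have := H 1 1; rewrite !mulr1 mul1r => /eqP.
by rewrite -subr_eq subrr eq_sym => /eqP.
Qed.

Lemma der_unique (F : series -> series) (fx fy : series) :
  fx [::] = 0 -> fy [::] = 0 -> cont F ->
  (forall f g, F (f * g) = F f * g + f * F g) ->
  F sX = fx -> F sY = fy -> F =1 der fx fy.
Proof.
move=> fx0 fy0 cF LF FX FY; apply: cont_ext => //; first exact: cont_der.
elim=> [|b w IH].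
  by rewrite (Leibniz_one LF) -[smono [::]]/(1 : series) der1.
rewrite smono_cons LF IH derM //.
by case: b => /=; rewrite -?[letter true]/sY -?[letter false]/sX ?FX ?FY ?derX ?derY.
Qed.

Lemma cont_der_pair (fx fy gx gy : series) c :
  fx [::] = 0 -> fy [::] = 0 -> gx [::] = 0 -> gy [::] = 0 ->
  der (c *: fx + gx) (c *: fy + gy) =1 fun f => c *: der fx fy f + der gx gy f.
Proof.
move=> fx0 fy0 gx0 gy0 f; apply: esym; move: f; apply: der_unique.
- by rewrite !at_ fx0 gx0 mulr0 addr0.
- by rewrite !at_ fy0 gy0 mulr0 addr0.
- split=> [d f g|n].
    rewrite !(cont_der _ _).1 // !scalerDr !scalerA mulrC.
    by rewrite addrACA -!scalerA.
  by exists n => f Hf; apply/vordD; [apply/vordZ|]; apply: slocal_der.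
- move=> f g; rewrite !derM // scalerDr mulrDl mulrDr -scalerAl -scalerAr.
  by rewrite addrACA.
- by rewrite !derX.
- by rewrite !derY.
Qed.

(** * Convergent sums *)

(** If [F k] has order at least k, the terms beyond the length of [u] vanish at [u], so the cut-off
    sum is the infinite one. *)
Definition ssum (F : nat -> series) : series :=
  fun u => \sum_(k < (size u).+1) F k u.

Definition summable (F : nat -> series) := forall k, vord k (F k).

Lemma ssumE F : summable F -> forall N u, (size u < N)%N ->
  ssum F u = \sum_(k < N) F k u.
Proof.
move=> sF N u HN; rewrite /ssum (big_ord_widen N (fun k => F k u)) //.
rewrite [LHS]big_mkcond; apply: eq_bigr => k _; case: ltnP => // Hk.
by rewrite (sF k).
Qed.

Lemma vord_ssum_tail F : summable F -> forall n,
  vord n (ssum F - \sum_(k < n) F k).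
Proof.
by move=> sF n w Hw; rewrite sub_at sum_at (ssumE sF Hw) subrr.
Qed.

Lemma ssum_cont F L : summable F -> cont L -> slocal L ->
  L (ssum F) = ssum (fun k => L (F k)).
Proof.
move=> sF cL lL; apply: sext => u; rewrite [RHS](_ : _ = L (\sum_(k < (size u).+1) F k) u); last first.
  by rewrite (cont_sum cL) sum_at.
have := lL _ _ (@vord_ssum_tail F sF (size u).+1) u (ltnSn _).
by rewrite (cont_sub cL) sub_at => /eqP; rewrite subr_eq0 => /eqP.
Qed.

Lemma slocal_mull g : slocal (fun f => g * f).
Proof. by move=> n f; apply: vordMl. Qed.
Lemma slocal_mulr g : slocal (fun f => f * g).
Proof. by move=> n f; apply: vordMr. Qed.

Lemma eq_ssum F G : F =1 G -> ssum F = ssum G.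
Proof. by move=> H; apply: sext => u; apply: eq_bigr => k _; rewrite H. Qed.

Lemma ssum_lin c F G : ssum (fun k => c *: F k + G k) = c *: ssum F + ssum G.
Proof.
apply: sext => u; rewrite !at_ /ssum mulr_sumr -big_split.
by apply: eq_bigr => k _; rewrite !at_.
Qed.

Lemma triangle (V : nmodType) (a : nat -> nat -> V) N :
  \sum_(n < N) \sum_(i < n.+1) a i (n - i)%N = \sum_(k < N) \sum_(l < N - k) a k l.
Proof.
elim: N => [|N IH]; first by rewrite !big_ord0.
rewrite big_ord_recr /= IH [RHS]big_ord_recr [\sum_(i < N.+1) _]big_ord_recr /=.
rewrite subSn // subnn big_ord1 addrA; congr (_ + _); rewrite -big_split /=.
apply: eq_bigr => k _; rewrite subSn 1?ltnW ?ltn_ord // big_ord_recr //=.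
Qed.

(** Summation by diagonals: on a given word the order bound leaves only the finitely many pairs with
    k + l at most its length. *)
Lemma ssum_double (B : nat -> nat -> series) :
  (forall k l, vord (k + l) (B k l)) ->
  ssum (fun k => ssum (B k)) = ssum (fun n => \sum_(i < n.+1) B i (n - i)%N).
Proof.
move=> HB; apply: sext => u; rewrite /ssum.
under [RHS]eq_bigr => n _ do rewrite sum_at.
rewrite (triangle (fun k l => B k l u)); apply: eq_bigr => k _.
rewrite [RHS](big_ord_widen _ (fun l => B k l u) (leq_subr k (size u).+1)) [RHS]big_mkcond.
apply: eq_bigr => l _; case: ltnP => // Hl; apply: HB.
by have := ltn_ord k; lia.
Qed.

Lemma ssumM F G : summable F -> summable G ->
  ssum F * ssum G = ssum (fun n => \sum_(i < n.+1) F i * G (n - i)%N).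
Proof.
move=> sF sG; rewrite (ssum_cont sF (cont_mulr _) (@slocal_mulr _)).
rewrite -(@ssum_double (fun k l => F k * G l)); last by move=> k l; apply: vordM.
by apply: eq_ssum => k; rewrite (ssum_cont sG (cont_mull _) (@slocal_mull _)).
Qed.

Lemma ssum_recl F : summable F -> ssum F = F 0%N + ssum (fun k => F k.+1).
Proof.
move=> sF; apply: sext => u; rewrite at_ (ssumE sF (N := (size u).+2)) //.
by rewrite big_ord_recl.
Qed.

Lemma expr_ord (f : series) n : vord 1 f -> vord n (f ^+ n).
Proof. by move=> Hf; elim: n => // n IH; rewrite exprS -add1n; apply: vordM. Qed.

Definition sinv (f : series) : series := ssum (fun k => (1 - f) ^+ k).

Lemma sinv_summable (f : series) : f [::] = 1 -> summable (fun k => (1 - f) ^+ k).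
Proof. by move=> f0 k; apply/expr_ord/vord1; rewrite !at_ f0 one_at subrr. Qed.

Lemma sinvl (f : series) : f [::] = 1 -> sinv f * f = 1.
Proof.
move=> f0; have sf := sinv_summable f0; rewrite -[f in _ * f](subKr 1).
rewrite mulrBr mulr1 (ssum_cont sf (cont_mulr _) (@slocal_mulr _)).
rewrite {1}/sinv (ssum_recl sf) expr0 -addrA (_ : _ - _ = 0) ?addr0 //.
apply/eqP; rewrite subr_eq0; apply/eqP/eq_ssum => k; by rewrite exprSr.
Qed.

Lemma sinvr (f : series) : f [::] = 1 -> f * sinv f = 1.
Proof.
move=> f0; have sf := sinv_summable f0; rewrite -[f in f * _](subKr 1).
rewrite mulrBl mul1r (ssum_cont sf (cont_mull _) (@slocal_mull _)).
rewrite {1}/sinv (ssum_recl sf) expr0 -addrA (_ : _ - _ = 0) ?addr0 //.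
by apply/eqP; rewrite subr_eq0; apply/eqP/eq_ssum => k; rewrite exprS.
Qed.

(** * Power series in x and in ad x *)

Definition xser (c : nat -> rat) : series :=
  fun w => if all negb w then c (size w) else 0.

Definition conv (c d : nat -> rat) : nat -> rat :=
  fun n => \sum_(i < n.+1) c i * d (n - i)%N.

Definition delta0 : nat -> rat := fun n => (n == 0%N)%:R.

Lemma xserM c d : xser c * xser d = xser (conv c d).
Proof.
apply: sext => w; rewrite mul_at /xser /conv.
have E i : all negb w = all negb (take i w) && all negb (drop i w).
  by rewrite -all_cat cat_take_drop.
case: ifP => Hw; last first.
  rewrite big1 // => i _; have := E i; rewrite Hw => /esym/negbT.
  by rewrite negb_and => /orP[]/negbTE->; rewrite ?mulr0 ?mul0r.
apply: eq_bigr => i _; have := E i; rewrite Hw => /esym/andP[-> ->].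
by rewrite size_drop size_takel // -ltnS ltn_ord.
Qed.

Lemma xser_delta0 : xser delta0 = 1.
Proof. by apply: sext => -[|b w]; rewrite /xser /delta0 one_at //=; case: ifP. Qed.

(** Coefficients of J(t) = (exp(t) - 1) / t; those of its inverse K(t), Bernoulli numbers over
    factorials, are read off in [cK] from the inverse of the series J(x). *)
Definition cJ : nat -> rat := fun n => (n.+1`!%:R)^-1.
Definition cK : nat -> rat := fun n => sinv (xser cJ) (nseq n false).
Definition cexp : nat -> rat := fun n => (n`!%:R)^-1.

Lemma convJK : conv cJ cK =1 delta0.
Proof.
move=> n; have H : (xser cJ * sinv (xser cJ)) (nseq n false) = delta0 n.
  by rewrite sinvr ?one_at; [case: n|rewrite /xser /cJ /= invr1].
rewrite -H mul_at size_nseq; apply: eq_bigr => i _; rewrite /cK /xser.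
have Hi : (i <= n)%N by rewrite -ltnS ltn_ord.
by rewrite take_nseq // drop_nseq all_nseq orbT size_nseq.
Qed.

Lemma conv_comm c d : conv c d =1 conv d c.
Proof.
move=> n; rewrite /conv [RHS](reindex_inj rev_ord_inj); apply: eq_bigr => i _ /=.
by rewrite subSS subKn 1?mulrC // -ltnS ltn_ord.
Qed.

Definition adx (f : series) : series := sX * f - f * sX.
Definition act (c : nat -> rat) (f : series) : series := ssum (fun k => c k *: iter k adx f).

Lemma cont_adx : cont adx.
Proof. by apply: contB; [exact: cont_mull|exact: cont_mulr]. Qed.

Lemma vord_adx n f : vord n f -> vord n.+1 (adx f).
Proof.
have H : vord 1 sX by exact: vord_smono.
move=> Hf; apply: vordB; first by rewrite -add1n; apply: vordM.
by rewrite -addn1; apply: vordM.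
Qed.

Lemma slocal_adx : slocal adx.
Proof. by move=> n f /vord_adx; apply: vord_le. Qed.

Lemma cont_iter_adx k : cont (iter k adx).
Proof. by elim: k => [|k IH]; [exact: cont_id|exact: (cont_comp cont_adx IH)]. Qed.

Lemma vord_iter_adx k n f : vord n f -> vord (k + n) (iter k adx f).
Proof. by move=> Hf; elim: k => // k IH /=; apply: vord_adx. Qed.

Lemma vord_iter_adx0 k f : vord k (iter k adx f).
Proof. by have := @vord_iter_adx k 0 f (@vord_any f); rewrite addn0. Qed.

Lemma slocal_iter_adx k : slocal (iter k adx).
Proof. by move=> n f Hf; apply: vord_le (@vord_iter_adx k n f Hf); apply: leq_addl. Qed.

Lemma act_summable c f : summable (fun k => c k *: iter k adx f).
Proof. by move=> k; apply/vordZ/vord_iter_adx0. Qed.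

Lemma slocal_act c : slocal (act c).
Proof.
move=> n f Hf w Hw; rewrite /act /ssum big1 // => k _.
by rewrite scale_at (@slocal_iter_adx k n f Hf w Hw) mulr0.
Qed.

Lemma cont_act c : cont (act c).
Proof.
split=> [d f g|n]; last by exists n => f; apply: slocal_act.
rewrite /act -ssum_lin; apply: eq_ssum => k.
by rewrite (cont_iter_adx k).1 scalerDr !scalerA mulrC.
Qed.

Lemma act_act c d f : act c (act d f) = act (conv c d) f.
Proof.
rewrite /act (eq_ssum (G := fun k => ssum (fun l => (c k * d l) *: iter (k + l) adx f))).
  rewrite ssum_double; last by move=> k l; apply/vordZ/vord_iter_adx0.
  apply: eq_ssum => n; rewrite /conv scaler_suml; apply: eq_bigr => i _.
  by rewrite subnKC // -ltnS ltn_ord.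
move=> k; rewrite (ssum_cont (@act_summable d f) (cont_iter_adx k) (@slocal_iter_adx k)).
apply: sext => w; rewrite at_ /ssum mulr_sumr; apply: eq_bigr => l _.
by rewrite (cont_scale (cont_iter_adx k)) !at_ mulrA iterD.
Qed.

Lemma eq_act c d f : c =1 d -> act c f = act d f.
Proof. by move=> H; apply: eq_ssum => k; rewrite H. Qed.

Lemma act_delta0 f : act delta0 f = f.
Proof.
rewrite /act (ssum_recl (@act_summable _ _)) /delta0 scale1r.
rewrite [X in _ + X](_ : _ = 0) ?addr0 //.
by apply: sext => w; rewrite /ssum big1 // => k _; rewrite scale0r.
Qed.

Lemma actJK f : act cJ (act cK f) = f.
Proof. by rewrite act_act (eq_act _ convJK) act_delta0. Qed.
Lemma actKJ f : act cK (act cJ f) = f.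
Proof.
by rewrite act_act (eq_act (d := delta0)) ?act_delta0 // => n; rewrite conv_comm convJK.
Qed.

Definition ex : series := xser cexp.
Definition exN : series := sinv ex.

Lemma ex_nil : ex [::] = 1.
Proof. by rewrite /ex /xser /cexp /= invr1. Qed.
Lemma exNl : exN * ex = 1. Proof. exact/sinvl/ex_nil. Qed.
Lemma exNr : ex * exN = 1. Proof. exact/sinvr/ex_nil. Qed.

Lemma sX_expE k w : (sX ^+ k) w = (w == nseq k false)%:R.
Proof.
elim: k w => [|k IH] w; first by rewrite expr0 one_at.
rewrite exprS letter_mul; case: w => [|b w] //; rewrite IH -natrM mulnb.
by rewrite eqseq_cons.
Qed.

Lemma xser_ssum c : xser c = ssum (fun k => c k *: sX ^+ k).
Proof.
apply: sext => w; rewrite /ssum /xser big_ord_recr big1 /= => [|k _]; last first.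
  rewrite at_ sX_expE; case: eqP => [E|]; rewrite ?mulr0 //.
  by have := ltn_ord k; rewrite {2}E size_nseq ltnn.
rewrite add0r at_ sX_expE; have -> : (w == nseq (size w) false) = all negb w.
  by elim: w => //= b w <-; rewrite eqseq_cons; case: b.
by case: all; rewrite ?mulr1 ?mulr0.
Qed.

Lemma xser_summable c : summable (fun k => c k *: sX ^+ k).
Proof. by move=> k; apply/vordZ/expr_ord/vord_smono. Qed.

Lemma cexpS k : cexp k = k.+1%:R * cexp k.+1.
Proof.
rewrite /cexp factS natrM invfM mulrA divff ?mul1r //.
by rewrite pnatr_eq0.
Qed.

(* The homogeneous parts U_n of both sides satisfy x U_n = (n + 1) U_(n+1). *)
Lemma adx_exp f : act cexp f * ex = ex * f.
Proof.
rewrite /ex xser_ssum /act ssumM; [|exact: act_summable|exact: xser_summable].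
rewrite (ssum_cont (@xser_summable _) (cont_mulr _) (@slocal_mulr _)).
apply: eq_ssum => n; set U := \sum_(_ < _) _.
pose A k := cexp k *: iter k adx f; pose v l : series := cexp l *: sX ^+ l.
have HA k : sX * A k = k.+1%:R *: A k.+1 + A k * sX.
  rewrite /A scalerA -cexpS /= {2}/adx -scalerAr -scalerAl scalerBr subrK //.
have Hv k : sX * v k = k.+1%:R *: v k.+1.
  by rewrite /v scalerA -cexpS -scalerAr -exprS.
rewrite -[RHS]/(v n * f) {}/U; under eq_bigr => i _ do rewrite -/(A i) -/(v (n - i)%N).
have A0 : A 0%N = f by rewrite /A /= /cexp invr1 scale1r.
have v0 : v 0%N = 1 by rewrite /v /cexp invr1 scale1r expr0.
clearbody A v; elim: n => [|n IH].
  by rewrite big_ord1 A0 v0 mulr1 mul1r.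
have nz : n.+1%:R != 0 :> rat by rewrite pnatr_eq0.
apply: (scalerI nz); rewrite scalerAl -Hv -mulrA -IH mulr_sumr.
have HAv i : sX * (A i * v (n - i)%N) =
    i.+1%:R *: (A i.+1 * v (n - i)%N) + (n - i).+1%:R *: (A i * v (n - i).+1).
  by rewrite mulrA HA mulrDl -[A i * sX * _]mulrA Hv -scalerAr -scalerAl.
under [RHS]eq_bigr => i _ do rewrite HAv.
have E1 : \sum_(i < n.+1) i.+1%:R *: (A i.+1 * v (n - i)%N) =
          \sum_(i < n.+2) i%:R *: (A i * v (n.+1 - i)%N).
  rewrite [RHS]big_ord_recl scale0r add0r; apply: eq_bigr => i _.
  by rewrite subSS.
have E2 : \sum_(i < n.+1) (n - i).+1%:R *: (A i * v (n - i).+1) =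
          \sum_(i < n.+2) (n.+1 - i)%:R *: (A i * v (n.+1 - i)%N).
  rewrite [RHS]big_ord_recr /= subnn scale0r addr0; apply: eq_bigr => i _.
  by rewrite subSn // -ltnS ltn_ord.
rewrite big_split /= E1 E2 scaler_sumr -big_split; apply: eq_bigr => i _ /=.
by rewrite -scalerDl -natrD subnKC // -ltnS ltn_ord.
Qed.

Lemma act_conj f : ex * f * exN = act cexp f.
Proof. by rewrite -adx_exp -mulrA exNr mulr1. Qed.

(** This is t J(t) = exp(t) - 1 at t = ad x, with exp(ad x) being conjugation by e. *)
Lemma adx_actJ f : adx (act cJ f) = ex * f * exN - f.
Proof.
rewrite act_conj /act (ssum_recl (@act_summable cexp f)) [X in _ = X *: _ + _ - _](_ : _ = 1) ?scale1r ?/cexp ?invr1 //.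
rewrite [RHS]addrC addrA addNr add0r (ssum_cont (@act_summable _ _) cont_adx slocal_adx).
by apply: eq_ssum => k; rewrite (cont_scale cont_adx) -iterS.
Qed.

(** * Closure properties of completed Lie algebras *)

Lemma cont_hcomp n : cont (hcomp n).
Proof.
split=> [c f g|m]; last by exists m => f Hf w Hw; rewrite /hcomp; case: eqP => // _; apply: Hf.
by apply: sext => w; rewrite !at_ /hcomp; case: eqP => // _; rewrite mulr0 addr0.
Qed.

Lemma hcomp_hcomp m n f : hcomp m (hcomp n f) = if m == n then hcomp n f else 0.
Proof.
apply: sext => w; case: (m =P n) => [->|Hn]; rewrite /hcomp; case: eqP => // ->.
by rewrite (introF eqP Hn).
Qed.

Lemma trunc_hcomp n f : trunc n f = \sum_(k < n) hcomp k f.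
Proof.
apply: sext => w; rewrite truncE sum_at /hcomp; case: ltnP => Hw.
  rewrite (bigD1 (Ordinal Hw)) //= eqxx big1 ?addr0 // => k /eqP Hk.
  by case: eqP => // E; case: Hk; apply: val_inj.
by rewrite big1 // => k _; case: eqP => // E; have := ltn_ord k; rewrite -E ltnNge Hw.
Qed.

Lemma hcompM n f g :
  hcomp n (f * g) = \sum_(i < n.+1) hcomp i f * hcomp (n - i) g.
Proof.
apply: sext => w; rewrite sum_at {1}/hcomp; case: eqP => Hw.
  rewrite mul_at Hw; apply: eq_bigr => i _.
  have Hi : (i < (size w).+1)%N by rewrite Hw.
  rewrite mul_at (bigD1 (Ordinal Hi)) //= big1 ?addr0 => [|j /eqP Hj].
    by rewrite /hcomp size_takel -1?ltnS // eqxx size_drop Hw eqxx.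
  rewrite /hcomp size_takel -1?ltnS //; case: eqP => [E|]; rewrite ?mul0r //.
  by case: Hj; apply: val_inj.
rewrite big1 // => i _; rewrite mul_at big1 // => j _; rewrite /hcomp.
case: eqP => Hi; rewrite ?mul0r //; case: eqP => Hj; rewrite ?mulr0 //.
by case: Hw; rewrite -(cat_take_drop j w) size_cat Hi Hj subnKC // -ltnS ltn_ord.
Qed.

(** Common shape of [lie_2] and [lie_C], both convertible to it, so that closure properties are
    proved once. *)
Definition Lie_complete (G : series -> Prop) (f : series) : Prop :=
  forall n, lie_span G (hcomp n f).

Section LieComplete.
Variable G : series -> Prop.
Hypothesis G_hom : forall g, G g -> exists n, g = hcomp n g.
Hypothesis G_inh : exists g, G g.

Lemma span0 : lie_span G 0.
Proof.
by have [g Gg] := G_inh; rewrite -(scale0r g); apply: ls_scale; apply: ls_gen.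
Qed.
Lemma spanD f g : lie_span G f -> lie_span G g -> lie_span G (f + g).
Proof. exact: ls_add. Qed.
Lemma spanZ c f : lie_span G f -> lie_span G (c *: f).
Proof. exact: ls_scale. Qed.
Lemma span_br f g : lie_span G f -> lie_span G g -> lie_span G (f * g - g * f).
Proof. exact: ls_br. Qed.
Lemma span_sum I (r : seq I) (F : I -> series) :
  (forall i, lie_span G (F i)) -> lie_span G (\sum_(i <- r) F i).
Proof. by move=> H; elim/big_rec: _ => [|i f _]; [exact: span0|apply: spanD]. Qed.

Lemma LCD f g : Lie_complete G f -> Lie_complete G g -> Lie_complete G (f + g).
Proof. by move=> Hf Hg n; rewrite (cont_add (cont_hcomp n)); apply: spanD. Qed.
Lemma LCZ c f : Lie_complete G f -> Lie_complete G (c *: f).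
Proof. by move=> Hf n; rewrite (cont_scale (cont_hcomp n)); apply: spanZ. Qed.
Lemma LCN f : Lie_complete G f -> Lie_complete G (- f).
Proof. by rewrite -scaleN1r; apply: LCZ. Qed.
Lemma LCB f g : Lie_complete G f -> Lie_complete G g -> Lie_complete G (f - g).
Proof. by move=> Hf Hg; apply/LCD/LCN. Qed.
Lemma LC0 : Lie_complete G 0.
Proof. by move=> n; rewrite (cont0 (cont_hcomp n)); apply: span0. Qed.
Lemma LC_sum I (r : seq I) (F : I -> series) :
  (forall i, Lie_complete G (F i)) -> Lie_complete G (\sum_(i <- r) F i).
Proof. by move=> H; elim/big_rec: _ => [|i f _]; [exact: LC0|apply: LCD]. Qed.

Lemma LC_br f g : Lie_complete G f -> Lie_complete G g -> Lie_complete G (f * g - g * f).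
Proof.
move=> Hf Hg n; rewrite (cont_sub (cont_hcomp n)) !hcompM.
rewrite [X in _ - X](reindex_inj rev_ord_inj) -sumrB; apply: span_sum => i /=.
by rewrite subSS subKn -1?ltnS ?ltn_ord //; apply: span_br.
Qed.

Lemma span_LC f : lie_span G f -> Lie_complete G f.
Proof.
elim=> [g Gg|g h _ Hg _ Hh|c g _ Hg|g h _ Hg _ Hh].
- have [m Hm] := G_hom Gg; move=> n; rewrite Hm hcomp_hcomp.
  by case: eqP => _; [rewrite -Hm; apply: ls_gen|apply: span0].
- exact: LCD.
- exact: LCZ.
- exact: LC_br.
Qed.

Lemma LC_ssum F : summable F -> (forall k, Lie_complete G (F k)) -> Lie_complete G (ssum F).
Proof.
move=> sF H n; have -> : hcomp n (ssum F) = hcomp n (\sum_(k < n.+1) F k).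
  apply/eqP; rewrite -subr_eq0 -(cont_sub (cont_hcomp n)); apply/eqP/sext => w.
  by rewrite /hcomp; case: eqP => // E; apply: (@vord_ssum_tail F sF n.+1); rewrite E.
exact: LC_sum.
Qed.
End LieComplete.

(** Each homogeneous part of [F f] sees only a truncation of [f], which is a finite sum of elements
    of the span. *)
Lemma LC_cont (G G' : series -> Prop) F : (exists g, G' g) -> cont F ->
  (forall f, lie_span G f -> Lie_complete G' (F f)) ->
  forall f, Lie_complete G f -> Lie_complete G' (F f).
Proof.
move=> G_inh cF HF f Hf n; have [m Hm] := cF.2 n.+1.
have -> : hcomp n (F f) = hcomp n (F (trunc m f)).
  apply/eqP; rewrite -subr_eq0 -(cont_sub (cont_hcomp n)) -(cont_sub cF).
  apply/eqP/sext => w; rewrite /hcomp; case: eqP => // E.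
  by apply: (Hm _ (@vord_trunc m f)); rewrite E.
rewrite trunc_hcomp (cont_sum cF); apply: LC_sum => // k.
exact/HF/Hf.
Qed.

Lemma LC_Leibniz (G : series -> Prop) F :
  (forall g, G g -> exists n, g = hcomp n g) -> (exists g, G g) -> cont F ->
  (forall f g, F (f * g) = F f * g + f * F g) ->
  (forall g, G g -> Lie_complete G (F g)) ->
  forall f, Lie_complete G f -> Lie_complete G (F f).
Proof.
move=> G_hom G_inh cF LF HG; apply: LC_cont => // f.
elim=> [g /HG //|g h _ Hg _ Hh|c g _ Hg|g h Gg Hg Gh Hh].
- by rewrite saddE (cont_add cF); apply: LCD.
- by rewrite sscaleE (cont_scale cF); apply: LCZ.
rewrite sbrE (cont_sub cF) !LF opprD [X in _ + X]addrC addrACA.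
apply: LCD; [|have := LC_br G_inh (span_LC G_hom G_inh Gg) Hh; by []].
exact: (LC_br G_inh Hg (span_LC G_hom G_inh Gh)).
Qed.

Notation genXY := (fun g => g = sX \/ g = sY).
Notation genC := (fun g => exists i, (0 < i)%N /\ g = sC i).

Lemma hcomp_smono n w : hcomp n (smono w) = if size w == n then smono w else 0.
Proof.
apply: sext => u; rewrite /hcomp; case: (size w =P n) => [<-|Hw].
  by rewrite !smonoE; case: (u =P w) => [->|_]; rewrite ?eqxx //; case: ifP.
by rewrite !smonoE; case: (u =P w) => [->|_]; rewrite ?(introF eqP Hw) //; case: ifP.
Qed.

Lemma genXY_hom g : genXY g -> exists n, g = hcomp n g.
Proof. by case=> ->; exists 1%N; rewrite hcomp_smono. Qed.
Lemma genXY_inh : exists g, genXY g.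
Proof. by exists sX; left. Qed.

Lemma sC1 : sC 1 = sY. Proof. by []. Qed.
Lemma sCS i : (0 < i)%N -> sC i.+1 = adx (sC i).
Proof. by case: i. Qed.

Lemma hcomp_adx n f : hcomp n.+1 (adx f) = adx (hcomp n f).
Proof.
apply: sext => w; rewrite /hcomp /adx !sub_at !letter_mul.
case: w => [|b w]; first by rewrite !mul_letter_nil subr0.
rewrite [b :: w]lastI !mul_letter size_rcons size_belast eqSS.
by case: eqP => // _; rewrite !mulr0 subr0.
Qed.

Lemma sC_hom i : (0 < i)%N -> sC i = hcomp i (sC i).
Proof.
case: i => // i _; elim: i => [|i IH]; first by rewrite sC1 hcomp_smono.
by rewrite sCS // hcomp_adx -IH.
Qed.

Lemma genC_hom g : genC g -> exists n, g = hcomp n g.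
Proof. by case=> i [Hi ->]; exists i; apply: sC_hom. Qed.
Lemma genC_inh : exists g, genC g.
Proof. by exists (sC 1), 1%N. Qed.

Lemma lie_C_sC i : (0 < i)%N -> lie_C (sC i).
Proof.
by move=> Hi; apply: (span_LC genC_hom genC_inh); apply: ls_gen; exists i.
Qed.

Lemma adx_Leibniz f g : adx (f * g) = adx f * g + f * adx g.
Proof. by rewrite /adx mulrBl mulrBr !mulrA addrA subrK. Qed.

Lemma lie_C_adx f : lie_C f -> lie_C (adx f).
Proof.
apply: (LC_Leibniz genC_hom genC_inh cont_adx adx_Leibniz) => g [i [Hi ->]].
by rewrite -sCS //; apply: lie_C_sC.
Qed.

Lemma lie_C_act c f : lie_C f -> lie_C (act c f).
Proof.
move=> Hf; apply: (LC_ssum genC_inh (@act_summable _ _)) => k.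
by apply: LCZ; elim: k => // k IH; apply: lie_C_adx.
Qed.

Lemma lie_C_der fx fy f : lie_C fx -> lie_C fy -> fx [::] = 0 -> fy [::] = 0 ->
  lie_C f -> lie_C (der fx fy f).
Proof.
move=> Hx Hy x0 y0; apply: (LC_Leibniz genC_hom genC_inh) => [||g [i [Hi ->]]].
- exact: cont_der.
- exact: derM.
case: i Hi => // i _; elim: i => [|i IH]; first by rewrite derY.
rewrite sCS // /adx (cont_sub (cont_der _ _)) !derM // derX // opprD [X in _ + X]addrC addrACA.
apply: (LCD (G := genC)); last exact: lie_C_adx.
exact: (LC_br genC_inh Hx (lie_C_sC _)).
Qed.

Lemma lie_2_der fx fy f : lie_2 fx -> lie_2 fy -> fx [::] = 0 -> fy [::] = 0 ->
  lie_2 f -> lie_2 (der fx fy f).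
Proof.
move=> Hx Hy x0 y0; apply: (LC_Leibniz genXY_hom genXY_inh) => [||g [->|->]].
- exact: cont_der.
- exact: derM.
- by rewrite derX.
- by rewrite derY.
Qed.

Lemma lie_C_subst p q f : p [::] = 0 -> q [::] = 0 -> lie_C p -> lie_C q ->
  lie_2 f -> lie_C (subst p q f).
Proof.
move=> p0 q0 Hp Hq; apply: LC_cont; [exact: genC_inh|exact: cont_subst|].
move=> g; elim=> [h [->|->]|h k _ Hh _ Hk|c h _ Hh|h k _ Hh _ Hk].
- by rewrite substX.
- by rewrite substY.
- by rewrite saddE (cont_add (cont_subst _ _)); apply: LCD.
- by rewrite sscaleE (cont_scale (cont_subst _ _)); apply: LCZ.
by rewrite sbrE (cont_sub (cont_subst _ _)) !substM //; apply: (LC_br genC_inh).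
Qed.

Lemma LC_at (G : series -> Prop) (P : word -> Prop) f :
  (forall g, G g -> forall w, P w -> g w = 0) ->
  (forall f g : series, (forall w, P w -> f w = 0) -> (forall w, P w -> g w = 0) ->
     forall w, P w -> (f * g - g * f) w = 0) ->
  Lie_complete G f -> forall w, P w -> f w = 0.
Proof.
move=> HG Hbr Hf w0 Pw0; have -> : f w0 = hcomp (size w0) f w0 by rewrite /hcomp eqxx.
move: (hcomp (size w0) f) (Hf (size w0)) => f' Hf'.
elim: Hf' w0 Pw0 => [g Gg|g h _ Hg _ Hh|c g _ Hg|g h _ Hg _ Hh] w Pw.
- exact: HG.
- by rewrite saddE at_ Hg ?Hh ?addr0.
- by rewrite sscaleE at_ Hg ?mulr0.
- by rewrite sbrE; apply: Hbr.
Qed.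

(** The condition under which ad x is injective ([comm_sX]). Every element of [lie_C] satisfies it,
    and the uniqueness of D y rests on it. *)
Definition xfree (f : series) := forall n, f (nseq n false) = 0.

Lemma xfreeMl f g : xfree f -> xfree (f * g).
Proof.
move=> Hf n; rewrite mul_at size_nseq big1 // => i _.
by rewrite take_nseq -1?ltnS // Hf mul0r.
Qed.
Lemma xfreeMr f g : xfree f -> xfree (g * f).
Proof.
by move=> Hf n; rewrite mul_at size_nseq big1 // => i _; rewrite drop_nseq Hf mulr0.
Qed.
Lemma xfreeD f g : xfree f -> xfree g -> xfree (f + g).
Proof. by move=> Hf Hg n; rewrite at_ Hf Hg addr0. Qed.
Lemma xfreeN f : xfree f -> xfree (- f).
Proof. by move=> Hf n; rewrite at_ Hf oppr0. Qed.
Lemma xfree_nil f : xfree f -> f [::] = 0.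
Proof. by move=> /(_ 0%N). Qed.

Lemma xfree_adx f : xfree f -> xfree (adx f).
Proof. by move=> Hf; apply/xfreeD/xfreeN; [apply: xfreeMr|apply: xfreeMl]. Qed.

Lemma lie_C_xfree f : lie_C f -> xfree f.
Proof.
move=> Hf n; apply: (LC_at (P := fun w => exists n, w = nseq n false) _ _ Hf); last by exists n.
  move=> g [[|i] [// _ ->]] w [m ->] {w}; elim: i m => [|i IH]; last by rewrite sCS //; apply: xfree_adx.
  by move=> [|[|m]].
move=> g h Hg _ w [m ->]; have xg : xfree g by move=> k; apply: Hg; exists k.
by apply/xfreeD/xfreeN; [apply: xfreeMl|apply: xfreeMr].
Qed.

Lemma lie_2_nil f : lie_2 f -> f [::] = 0.
Proof.
move=> Hf; apply: (LC_at (P := fun w => w = [::]) _ _ Hf) => // [g|g h Hg Hh] .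
  by case=> -> w ->.
by move=> w ->; rewrite sub_at !mul_nil mulrC subrr.
Qed.

Lemma xfree_der fx fy f : xfree fx -> xfree fy -> xfree (der fx fy f).
Proof.
move=> Hx Hy n; rewrite /der big1 // => k _; rewrite big1 // => w _.
suff H : xfree (der_word fx fy w) by rewrite H mulr0.
elim: w => [|b w IH] m; first by rewrite der_word_nil.
by rewrite der_word_cons; apply: xfreeD; [apply: xfreeMl; case: b|apply: xfreeMr].
Qed.

Lemma xfree_act c f : xfree f -> xfree (act c f).
Proof.
move=> Hf n; rewrite /act /ssum big1 // => k _; rewrite at_.
suff H m : xfree (iter m adx f) by rewrite H mulr0.
by elim: m => // m IH; apply: xfree_adx.
Qed.

(** From x f = f x, trailing letters x may be moved to the front of a word; once the word ends in y
    its coefficient is 0. So [f] lives on powers of x, where it vanishes by hypothesis. *)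
Lemma comm_sX f : xfree f -> adx f = 0 -> f = 0.
Proof.
move=> xf Hf.
have H b u c : (b == false)%:R * f (rcons u c) = (c == false)%:R * f (b :: u).
  have := congr1 (fun g : series => g (rcons (b :: u) c)) Hf.
  by rewrite /adx sub_at letter_mul mul_letter /= => /subr0_eq.
have Hy u m : f (u ++ true :: nseq m false) = 0.
  elim: m u => [|m IH] u.
    by rewrite cats1; have := H false u true; rewrite mul1r mul0r.
  rewrite -[true :: nseq _ _]cat1s (_ : nseq m.+1 false = rcons (nseq m false) false).
    rewrite catA -rcons_cat; have := H false ((u ++ [:: true]) ++ nseq m false) false.
    by rewrite !mul1r => ->; rewrite -catA -cat_cons IH.
  by rewrite -cats1 -[[:: false]]/(nseq 1 false) -nseqD addn1.
have Hw w : (exists n, w = nseq n false) \/ exists u m, w = u ++ true :: nseq m false.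
  elim/last_ind: w => [|w b IH]; first by left; exists 0%N.
  case: b; first by right; exists w, 0%N; rewrite cats1.
  case: IH => [[n ->]|[u [m ->]]]; [left; exists n.+1|right; exists u, m.+1].
    by rewrite -cats1 -[[:: false]]/(nseq 1 false) -nseqD addn1.
  rewrite -cats1 -catA cat_cons -[[:: false]]/(nseq 1 false) -nseqD addn1 //.
by apply: sext => w; case: (Hw w) => [[n ->]|[u [m ->]]]; rewrite ?xf ?Hy.
Qed.

(** * The elliptic derivation attached to a special derivation *)

Definition px : series := - act cK sY.
Definition py : series := - (ex * px * exN).
Definition ell_subst : series -> series := subst px py.

(** The solution D x of D e = e alpha - beta e, obtained by inverting J(ad x) in [der_ex]; alpha and
    beta are the images of the two components. *)
Definition gamma (e : series * series) : series :=
  act cK (ex * ell_subst e.1 * exN - ell_subst e.2).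

(** The unknown D y enters D p only through - K(ad x)(D y), and [der (gamma e) 0 px] is the rest of
    D p; applying J(ad x) solves D p = [p, alpha] for D y. *)
Definition gamma_y (e : series * series) : series :=
  act cJ (der (gamma e) 0 px - (px * ell_subst e.1 - ell_subst e.1 * px)).

Lemma lie_C_ex_conj f : lie_C f -> lie_C (ex * f * exN).
Proof. by move=> Hf; rewrite act_conj; apply: lie_C_act. Qed.

Lemma lie_C_px : lie_C px.
Proof. exact/LCN/lie_C_act/(@lie_C_sC 1). Qed.
Lemma lie_C_py : lie_C py.
Proof. exact/LCN/lie_C_ex_conj/lie_C_px. Qed.
Lemma px_nil : px [::] = 0. Proof. exact/xfree_nil/lie_C_xfree/lie_C_px. Qed.
Lemma py_nil : py [::] = 0. Proof. exact/xfree_nil/lie_C_xfree/lie_C_py. Qed.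

Lemma cont_ell : cont ell_subst. Proof. exact: cont_subst. Qed.
Lemma ellM f g : ell_subst (f * g) = ell_subst f * ell_subst g.
Proof. exact/substM/py_nil/px_nil. Qed.
Lemma ellX : ell_subst sX = px. Proof. exact/substX/py_nil/px_nil. Qed.
Lemma ellY : ell_subst sY = py. Proof. exact/substY/py_nil/px_nil. Qed.
Lemma ell1 : ell_subst 1 = 1. Proof. exact/subst1/py_nil/px_nil. Qed.
Lemma ell_comm f g : ell_subst (f * g - g * f) = ell_subst f * ell_subst g - ell_subst g * ell_subst f.
Proof. by rewrite (cont_sub cont_ell) !ellM. Qed.

Lemma py_ex : py * ex = - (ex * px).
Proof. by rewrite /py mulNr -[_ * exN * _]mulrA exNl mulr1. Qed.

(** p + q = - (exp(ad x) - 1) p = - ad x J(ad x) p, and J cancels the K in p. *)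
Lemma px_py : px + py = sX * sY - sY * sX.
Proof.
have -> : px + py = - adx (act cJ px) by rewrite adx_actJ opprB.
rewrite /px (cont_opp (cont_act _)) actJK (cont_opp cont_adx).
by rewrite opprK.
Qed.

Section Elliptic.
Variable e : series * series.
Hypothesis He : sder2 e.
Local Notation a := (e.1).
Local Notation b := (e.2).
Local Notation alpha := (ell_subst a).
Local Notation beta := (ell_subst b).
Local Notation B := (gamma e).
Local Notation C := (gamma_y e).
Local Notation D := (der B C).

Lemma lie_C_ell f : lie_2 f -> lie_C (ell_subst f).
Proof.
by apply: lie_C_subst; [exact: px_nil|exact: py_nil|exact: lie_C_px|exact: lie_C_py].
Qed.

Lemma lie_C_gamma : lie_C B.
Proof.
have [Ha [Hb _]] := He.
by apply/lie_C_act/(LCB (G := genC)); [apply/lie_C_ex_conj/lie_C_ell|apply: lie_C_ell].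
Qed.

Lemma gamma_xfree : xfree B. Proof. exact/lie_C_xfree/lie_C_gamma. Qed.
Lemma gamma_nil : B [::] = 0. Proof. exact/xfree_nil/gamma_xfree. Qed.

Lemma lie_C_gamma_y : lie_C C.
Proof.
have [Ha _] := He.
apply/lie_C_act/(LCB (G := genC)).
  apply: lie_C_der; [exact: lie_C_gamma|exact: (LC0 genC_inh)|exact: gamma_nil|by []|].
  exact: lie_C_px.
exact: (LC_br genC_inh lie_C_px (lie_C_ell Ha)).
Qed.
Lemma gamma_y_xfree : xfree C. Proof. exact/lie_C_xfree/lie_C_gamma_y. Qed.
Lemma gamma_y_nil : C [::] = 0. Proof. exact/xfree_nil/gamma_y_xfree. Qed.

Lemma cont_D : cont D. Proof. exact: cont_der. Qed.
Lemma DM f g : D (f * g) = D f * g + f * D g.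
Proof. exact/derM/gamma_y_nil/gamma_nil. Qed.
Lemma DX : D sX = B. Proof. exact/derX/gamma_y_nil/gamma_nil. Qed.
Lemma DY : D sY = C. Proof. exact/derY/gamma_y_nil/gamma_nil. Qed.

Lemma der_act0 fy c f : fy [::] = 0 -> der 0 fy (act c f) = act c (der 0 fy f).
Proof.
move=> fy0; rewrite /act (ssum_cont (@act_summable _ _) (cont_der _ _) (@slocal_der _ _)).
apply: eq_ssum => k; rewrite (cont_scale (cont_der _ _)); congr (_ *: _).
elim: k => //= k <-; rewrite /adx (cont_sub (cont_der _ _)) !derM //.
by rewrite derX // mul0r add0r mulr0 addr0.
Qed.

Lemma D_px : D px = px * alpha - alpha * px.
Proof.
have -> : D px = der B 0 px + der 0 C px.
  have := @cont_der_pair B 0 0 C 1 gamma_nil erefl erefl gamma_y_nil px.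
  by rewrite !scale1r addr0 add0r.
rewrite /px (cont_opp (cont_der 0 C)) der_act0 ?gamma_y_nil // derY ?gamma_y_nil //.
by rewrite /gamma_y actKJ opprB addrCA subrr addr0.
Qed.
End Elliptic.

(* The difference of the two sides commutes with x and has no term in x alone. *)
Lemma der_ex fx fy : xfree fx -> xfree fy -> der fx fy ex = act cJ fx * ex.
Proof.
move=> Hx Hy; have x0 := xfree_nil Hx; have y0 := xfree_nil Hy.
apply/eqP; rewrite -subr_eq0; apply/eqP/comm_sX.
  by apply/xfreeD/xfreeN; [apply: xfree_der|apply/xfreeMl/xfree_act].
have Ex : sX * ex = ex * sX.
  rewrite /ex xser_ssum (ssum_cont (@xser_summable _) (cont_mull _) (@slocal_mull _)).
  rewrite (ssum_cont (@xser_summable _) (cont_mulr _) (@slocal_mulr _)).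
  by apply: eq_ssum => k; rewrite -scalerAr -scalerAl -exprS -exprSr.
rewrite (cont_sub cont_adx); have := congr1 (der fx fy) Ex; rewrite !derM // derX //.
rewrite adx_Leibniz [adx ex]/adx Ex subrr mulr0 addr0 adx_actJ mulrBl -[_ * exN * _]mulrA exNl mulr1.
rewrite /adx => H; apply: sext => w; move/(congr1 (fun g : series => g w)): H.
by rewrite !at_ => H; lra.
Qed.

Section Elliptic2.
Variable e : series * series.
Hypothesis He : sder2 e.
Local Notation a := (e.1).
Local Notation b := (e.2).
Local Notation alpha := (ell_subst a).
Local Notation beta := (ell_subst b).
Local Notation B := (gamma e).
Local Notation C := (gamma_y e).
Local Notation D := (der B C).

Lemma D_ex : D ex = ex * alpha - beta * ex.
Proof.
rewrite der_ex; [|exact: gamma_xfree|exact: gamma_y_xfree].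
by rewrite /gamma actJK mulrBl -[_ * exN * _]mulrA exNl mulr1.
Qed.

Lemma mulIex (f g : series) : f * ex = g * ex -> f = g.
Proof. by move=> /(congr1 (fun h => h * exN)); rewrite -!mulrA exNr !mulr1. Qed.

Lemma D_py : D py = py * beta - beta * py.
Proof.
(* Differentiate q e = - e p and solve for D q, cancelling e on the right. *)
apply: mulIex; have := congr1 D py_ex; rewrite (cont_opp (cont_D e)) !(DM He) D_ex (D_px He).
move=> /(canRL (addrK _)) ->.
rewrite !mulrBl !mulrBr !mulrA py_ex -[beta * py * ex]mulrA py_ex !mulNr !mulrN.
(* Once expanded, each noncommutative monomial is an atom, so comparing coefficients at [w] leaves a
   linear identity over the rationals. *)
rewrite !mulrA; apply: sext => w; rewrite !at_; ring.
Qed.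

Lemma D_ell f : D (ell_subst f) = ell_subst (Eop e f).
Proof.
have [Ha [Hb _]] := He.
have x0 : sbr sX e.1 [::] = 0 by rewrite sbrE sub_at !mul_nil mulrC subrr.
have y0 : sbr sY e.2 [::] = 0 by rewrite sbrE sub_at !mul_nil mulrC subrr.
move: f; apply: cont_ext => [||w].
- exact: (cont_comp (cont_D e) cont_ell).
- exact: (cont_comp cont_ell (cont_der _ _)).
elim: w => [|c w IH].
  by rewrite smono_nil ell1 /Eop !der1 ?(cont0 cont_ell) ?gamma_nil ?gamma_y_nil.
rewrite smono_cons ellM (DM He) IH /Eop derM // (cont_add cont_ell) !ellM; congr (_ * _ + _).
case: c; rewrite -?[letter true]/sY -?[letter false]/sX.
  by rewrite ellY D_py derY // sbrE ell_comm ellY.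
by rewrite ellX (D_px He) derX // sbrE ell_comm ellX.
Qed.

(** [x, y] = p + q is the image of x + y, which a special derivation kills. *)
Lemma D_comm : D (sX * sY - sY * sX) = 0.
Proof.
have [Ha [Hb [_ [_ H]]]] := He.
rewrite -px_py (cont_add (cont_D e)) (D_px He) D_py -ellX -ellY -!ell_comm.
rewrite -(cont_add cont_ell) -[X in ell_subst X]/(sadd (sbr sX e.1) (sbr sY e.2)) H.
exact: (cont0 cont_ell).
Qed.

Lemma gamma_assoc : assoc_a B C.
Proof. by split; [exact: lie_C_gamma_y|rewrite sbrE D_comm]. Qed.

Lemma assoc_eq : B * sY - sY * B + (sX * C - C * sX) = 0.
Proof.
rewrite -D_comm (cont_sub (cont_D e)) !(DM He) (DX He) (DY He).
by apply: sext => w; rewrite !at_; ring.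
Qed.
End Elliptic2.

(** Subtracting the two equations leaves [x, C - C'] = 0, and elements of [lie_C] have no term in x
    alone. *)
Lemma assoc_unique B C C' : lie_C B -> assoc_a B C -> assoc_a B C' -> C = C'.
Proof.
move=> HB [HC EC] [HC' EC']; have B0 := xfree_nil (lie_C_xfree HB).
apply/eqP; rewrite -subr_eq0; apply/eqP/comm_sX.
  by apply/xfreeD/xfreeN; apply: lie_C_xfree.
move: EC EC'; rewrite !sbrE !(cont_sub (cont_der _ _)) !derM ?(xfree_nil (lie_C_xfree _)) //.
rewrite !derX ?derY ?(xfree_nil (lie_C_xfree _)) // => EC EC'.
rewrite /adx; have := congr1 (fun g => g - szero) EC; rewrite -{1}EC' => H.
apply: sext => w; move/(congr1 (fun g : series => g w)): H.
by rewrite !mulrBl !mulrBr !at_ /szero => H; lra.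
Qed.

(** * Linearity and compatibility with brackets *)

Definition sder_br (e e' : series * series) : series * series :=
  (e.1 * e'.1 - e'.1 * e.1 + Eop e e'.1 - Eop e' e.1,
   e.2 * e'.2 - e'.2 * e.2 + Eop e e'.2 - Eop e' e.2).

Lemma gamma_linear c e e' :
  gamma (padd (pscale c e) e') = c *: gamma e + gamma e'.
Proof.
rewrite /gamma /padd /pscale /= !saddE !sscaleE.
rewrite !cont_ell.1 -(cont_act cK).1; congr (act cK _).
rewrite mulrDr mulrDl -scalerAr -scalerAl scalerBr opprD; apply: sext => w; rewrite !at_; ring.
Qed.

Lemma comm_Leibniz (D D' : series -> series) : cont D -> cont D' ->
  (forall f g, D (f * g) = D f * g + f * D g) ->
  (forall f g, D' (f * g) = D' f * g + f * D' g) ->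
  forall f g, D (D' (f * g)) - D' (D (f * g)) =
    (D (D' f) - D' (D f)) * g + f * (D (D' g) - D' (D g)).
Proof.
move=> cD cD' LD LD' f g; rewrite LD LD' (cont_add cD) (cont_add cD') !LD !LD'.
by rewrite mulrBl mulrBr; apply: sext => w; rewrite !at_; ring.
Qed.

(** The commutator of D and D' is a derivation whose value on e is again e alpha'' - beta'' e, now
    for the bracket pair; [der_ex] recovers its value on x. *)
Lemma gamma_br e e' : sder2 e -> sder2 e' ->
  gamma (sder_br e e') =
  der (gamma e) (gamma_y e) (gamma e') - der (gamma e') (gamma_y e') (gamma e).
Proof.
move=> He He'; set D := der _ _; set D' := der _ (gamma_y e').
pose F f := D (D' f) - D' (D f).
have cF : cont F.
  by apply: contB; [exact: (cont_comp (cont_D e) (cont_D e'))|exact: (cont_comp (cont_D e') (cont_D e))].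
have LF : forall f g, F (f * g) = F f * g + f * F g.
  exact: (comm_Leibniz (cont_D e) (cont_D e') (DM He) (DM He')).
have xX : xfree (F sX).
  rewrite /F /D /D' (DX He) (DX He').
  by apply/xfreeD/xfreeN; apply: xfree_der; (try exact: gamma_xfree); exact: gamma_y_xfree.
have xY : xfree (F sY).
  by apply/xfreeD/xfreeN; apply: xfree_der; (try exact: gamma_xfree); exact: gamma_y_xfree.
have Fder : F =1 der (F sX) (F sY).
  by apply: der_unique => //; exact: xfree_nil.
have Fex : F ex = ex * ell_subst (sder_br e e').1 - ell_subst (sder_br e e').2 * ex.
  rewrite /F /D /D' !D_ex // !(cont_sub (cont_D _)) !(DM He) !(DM He') !D_ex // !D_ell //.
  rewrite /= !(cont_add cont_ell) !(cont_opp cont_ell) !ellM.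
  rewrite !(mulrDl, mulrDr, mulNr, mulrN, opprD) !mulrA.
  by apply: sext => w; rewrite !at_; ring.
have := Fder ex; rewrite der_ex // Fex => /(congr1 (fun g => g * exN)).
rewrite -!mulrA exNr mulr1 mulrBl -!mulrA exNr mulr1 mulrA => H.
by rewrite /gamma H actKJ /F /D /D' (DX He) (DX He').
Qed.

(** * Injectivity *)

Lemma cK0 : cK 0%N = 1.
Proof. by have := convJK 0; rewrite /conv big_ord1 /cJ invr1 mul1r. Qed.

Lemma px_ord : vord 2 (px + sY).
Proof.
rewrite /px /act (ssum_recl (@act_summable _ _)) cK0 scale1r /= opprD addrAC addNr add0r.
apply: vordN => w Hw; rewrite /ssum big1 // => k _.
have := @vord_iter_adx k.+1 1 sY (@vord_smono 1 [:: true] isT); rewrite at_ /= => -> //.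
  by rewrite mulr0.
by apply: leq_trans Hw _; lia.
Qed.

Lemma sX_cons f b w : (sX * f) (b :: w) = (b == false)%:R * f w.
Proof. exact: letter_mul. Qed.
Lemma sY_cons f b w : (sY * f) (b :: w) = (b == true)%:R * f w.
Proof. exact: letter_mul. Qed.

(* Compare the lowest degrees, using px = - y + O(2). *)
Lemma px_comm_free (h g : series) : px * h + (sX * sY - sY * sX) * g = 0 -> h = 0 /\ g = 0.
Proof.
move=> H.
have E b w : (b == true)%:R * h w =
   ((px + sY) * h) (b :: w) + ((sX * sY - sY * sX) * g) (b :: w).
  have := congr1 (fun f : series => f (b :: w)) H.
  rewrite [(px + sY) * h]mulrDl !at_ sY_cons => H1; lra.
have Hn n : vord n.+1 h /\ vord n g.
  elim: n => [|n [IHh IHg]].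
    split=> //; apply: vord1; have := E true [::]; rewrite mul1r => ->.
    rewrite (@vordMr 2 _ _ px_ord) // add0r (@vordMr 2) //.
    by apply: vordB; apply: (@vordM 1 1); apply: vord_smono.
  have g0 : vord n.+1 g.
    move=> w; rewrite ltnS leq_eqVlt => /orP[/eqP Hw|]; last exact: IHg.
    have := E false (true :: w); rewrite mul0r (vordM px_ord IHh) ?add0r; last by rewrite /= Hw; lia.
    by rewrite mulrBl !at_ -!mulrA !(sX_cons, sY_cons) /= !(mul1r, mul0r) subr0.
  split=> // w; rewrite ltnS leq_eqVlt => /orP[/eqP Hw|]; last exact: IHh.
  have := E true w; rewrite mul1r => ->.
  rewrite (vordM px_ord IHh) ?add0r; last by rewrite /= Hw; lia.
  rewrite (vordM (m := 2) _ g0) //; last by rewrite /= Hw; lia.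
  by apply: vordB; apply: (@vordM 1 1); apply: vord_smono.
split; apply: vord_zero => n; have [] := Hn n => //.
by move=> Hh _; apply: vord_le Hh.
Qed.

Lemma lq_decomp f : f = f [::] *: 1 + sX * lq false f + sY * lq true f.
Proof.
apply: sext => -[|b w]; rewrite !at_ one_at.
  by rewrite !mul_nil /sX /sY !smonoE /= !mul0r !addr0 mulr1.
by rewrite sX_cons sY_cons /lq; case: b; rewrite /= !(mulr0, mul0r, mul1r, add0r, addr0).
Qed.

(** With f = x f' + y f'' and q = [x, y] - p, the image is p (f' - f'') + [x, y] f'' after
    substitution in f' and f''. By [px_comm_free] both images vanish, and the word gets shorter. *)
Lemma ell_subst_inj f : ell_subst f = 0 -> f = 0.
Proof.
move=> H; apply: sext => w; elim: w f H => [|b w IH] f H.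
  have := congr1 (fun g : series => g [::]) H.
  by rewrite /ell_subst subst_nil ?px_nil ?py_nil.
have f0 : f [::] = 0.
  by have := congr1 (fun g : series => g [::]) H; rewrite /ell_subst subst_nil ?px_nil ?py_nil.
move: H; rewrite (lq_decomp f) f0 scale0r add0r (cont_add cont_ell) !ellM ellX ellY.
rewrite -[py](addKr px) px_py mulrDl [- px * _]mulNr => H.
have [] := @px_comm_free (ell_subst (lq false f) - ell_subst (lq true f)) (ell_subst (lq true f)).
  by rewrite mulrBr -addrA.
move=> H1 H2; rewrite H2 subr0 in H1.
rewrite -[RHS](zero_at w); case: b; [rewrite -(IH _ H2)|rewrite -(IH _ H1)].
  by rewrite !at_ sX_cons sY_cons /= mul0r mul1r add0r.
by rewrite !at_ sX_cons sY_cons /= mul0r mul1r addr0.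
Qed.

(** On powers of x the product of series is commutative, so brackets vanish there and only the
    linear term could survive. *)
Lemma lie_2_xfree f : lie_2 f -> f [:: false] = 0 -> xfree f.
Proof.
move=> Hf f1 n; case: (n =P 1%N) => [->//|Hn].
apply: (LC_at (P := fun w => exists2 n, n <> 1%N & w = nseq n false) _ _ Hf); last by exists n.
  by move=> g [->|->] w [m Hm ->]; case: m Hm => [|[|m]].
move=> g h _ _ w [m _ ->]; rewrite sub_at !mul_at size_nseq.
rewrite [X in _ - X](reindex_inj rev_ord_inj) /= -sumrB big1 // => i _.
have Hi := ltn_ord i; rewrite !take_nseq ?drop_nseq; [|lia|lia].
by rewrite subSS subKn 1?mulrC ?subrr // -ltnS ltn_ord.
Qed.

(** D x = 0 forces D y = 0, hence D = 0. Then [p, alpha] = D p = 0 gives [x, a] = 0, so a = 0, and D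
    e = 0 gives beta = 0. *)
Lemma gamma_inj0 e : sder2 e -> gamma e = 0 -> e.1 = 0 /\ e.2 = 0.
Proof.
move=> He H; have [Ha [Hb [a1 _]]] := He.
have C0 : gamma_y e = 0.
  apply: (assoc_unique (lie_C_gamma He) (gamma_assoc He)); split; first exact: (LC0 genC_inh).
  rewrite sbrE (cont_sub (cont_der _ _)) !derM ?gamma_nil // derX ?derY ?gamma_nil // H.
  by rewrite !(mul0r, mulr0, addr0, oppr0).
have D0 f : der (gamma e) (gamma_y e) f = 0.
  rewrite H C0; have := @cont_der_pair 0 0 0 0 (-1) erefl erefl erefl erefl f.
  by rewrite !scaler0 !addr0 scaleN1r addNr.
have Ea : e.1 = 0.
  have xa : xfree e.1 by exact: lie_2_xfree.
  apply: comm_sX xa _; apply: ell_subst_inj; rewrite ell_comm ellX -(D_px He).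
  exact: D0.
split=> //; apply: ell_subst_inj.
have := D_ex He; rewrite D0 Ea (cont0 cont_ell) mulr0 sub0r => /esym/(congr1 (fun f => - f * exN)).
by rewrite opprK -mulrA exNr mulr1 oppr0 mul0r.
Qed.

(** * Cyclic words *)

(** Concrete model of the trace: two series have the same trace exactly when their [cyc] agree
    ([tr_eqP]). The empty word is separate because an empty sum would lose the constant term. *)
Definition cyc (f : series) : series :=
  fun w => if w is [::] then f [::] else \sum_(i < size w) f (rot i w).

Lemma rot_sum (V : nmodType) (F : word -> V) w :
  \sum_(i < size w) F (rot i (rot 1 w)) = \sum_(i < size w) F (rot i w).
Proof.
case: w => [|b w]; first by rewrite !big_ord0.
have E i : (i <= size w)%N -> rot i (rot 1 (b :: w)) = rot i.+1 (b :: w).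
  by move=> Hi; rewrite rot_add_mod //= ?addn1 ?ltnS ?Hi // ltnW.
rewrite -[size (b :: w)]/((size w).+1) [LHS]big_ord_recr [RHS]big_ord_recl [LHS]addrC.
congr (_ + _).
  by rewrite E //= rot0 -[(size w).+1]/(size (b :: w)) rot_size.
apply: eq_bigr => i _; rewrite E ?lift0 //; exact: ltnW (ltn_ord i).
Qed.

Lemma cyc_rot f w : cyc f (rot 1 w) = cyc f w.
Proof.
have := rot_sum f w; rewrite /cyc; case: w => [|b w] //= H.
rewrite -H /rot /= drop0 take0 size_cat addn1; case: (w ++ _) (size_cat w [:: b]) => [|c v] //=.
by rewrite addn1.
Qed.

Lemma slocal_cyc : slocal cyc.
Proof.
move=> n f Hf [|b w] Hw; first exact: Hf.
by rewrite /cyc big1 // => i _; apply: Hf; rewrite size_rot.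
Qed.

Lemma cont_cyc : cont cyc.
Proof.
split=> [c f g|n]; last by exists n => f; apply: slocal_cyc.
apply: sext => -[|b w]; rewrite /cyc !at_ // mulr_sumr -big_split.
by apply: eq_bigr => i _; rewrite !at_.
Qed.

Lemma cyc_smono_rot w : cyc (smono (rot 1 w)) = cyc (smono w).
Proof.
apply: sext => -[|b v]; first by case: w => [|c [|d w]].
rewrite /cyc -rot_sum; apply: eq_bigr => i _; rewrite !smonoE.
have -> : rot i (rot 1 (b :: v)) = rot 1 (rot i (b :: v)).
  by rewrite !rot_add_mod ?size_rot //= ?[(1 + _)%N]addnC // ltnW.
by rewrite (inj_eq (@rot_inj 1 _)).
Qed.

Lemma cyc_smono_cat u v : cyc (smono (u ++ v)) = cyc (smono (v ++ u)).
Proof.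
elim: u v => [|b u IH] v; first by rewrite cats0.
by rewrite -[LHS]cyc_smono_rot /= rot1_cons rcons_cat IH cat_rcons.
Qed.

Lemma cycM f g : cyc (f * g) = cyc (g * f).
Proof.
move: f; apply: cont_ext => [||u].
- exact: (cont_comp cont_cyc (cont_mulr g)).
- exact: (cont_comp cont_cyc (cont_mull g)).
move: g; apply: cont_ext => [||v].
- exact: (cont_comp cont_cyc (cont_mull _)).
- exact: (cont_comp cont_cyc (cont_mulr _)).
by rewrite -!smono_cat cyc_smono_cat.
Qed.

Lemma cyc_commutator f g : cyc (f * g - g * f) = 0.
Proof. by rewrite (cont_sub cont_cyc) cycM subrr. Qed.

Lemma words_uniq k : uniq (words k).
Proof.
elim: k => [|k IH] //=; rewrite cats0 cat_uniq !map_inj_uniq ?IH //=; last by move=> u v [].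
  by rewrite andbT; apply/hasPn => w /mapP[v _ ->]; apply/mapP => -[u _ []].
by move=> u v [].
Qed.

Lemma mem_words k w : (w \in words k) = (size w == k).
Proof.
apply/idP/eqP => [/size_words//|<-]; elim: w => [|b w IH] //=.
by rewrite cats0 mem_cat; case: b; rewrite ?(map_f _ IH) ?orbT.
Qed.

Lemma big_words_rot (V : nmodType) k (F : word -> V) i :
  \sum_(w <- words k) F (rot i w) = \sum_(w <- words k) F w.
Proof.
rewrite -(big_map (rot i) predT F); apply: perm_big; apply: uniq_perm.
- by rewrite map_inj_uniq ?words_uniq //; exact: rot_inj.
- exact: words_uniq.
move=> w; rewrite mem_words; apply/mapP/eqP => [[v Hv ->]|Hw].
  by rewrite size_rot (size_words Hv).
by exists (rotr i w); rewrite ?rotrK // mem_words size_rotr Hw.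
Qed.

(* By invariance of c, averaging over the rotations replaces f by cyc f / k. *)
Lemma cyc_pairing (V : lmodType rat) k (c : word -> V) f :
  (forall w, size w = k -> c (rot 1 w) = c w) -> cyc f = 0 ->
  \sum_(w <- words k) f w *: c w = 0.
Proof.
case: k => [|k] Hc Hf.
  by rewrite big_words0 -[f [::]]/(cyc f [::]) Hf scale0r.
have Hci i w : size w = k.+1 -> (i <= k.+1)%N -> c (rot i w) = c w.
  move=> Hw; elim: i => [|i IH] Hi; first by rewrite rot0.
  by rewrite rotS ?Hw // Hc ?size_rot // IH // ltnW.
have nz : k.+1%:R != 0 :> rat by rewrite pnatr_eq0.
apply: (scalerI nz); rewrite scaler0.
rewrite (_ : _ *: _ = \sum_(i < k.+1) \sum_(w <- words k.+1) f (rot i w) *: c w).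
  rewrite exchange_big big_seq big1 // => w /size_words Hw.
  rewrite -scaler_suml; have -> : \sum_(i < k.+1) f (rot i w) = cyc f w.
    by rewrite /cyc; case: w Hw => // b w <-.
  by rewrite Hf scale0r.
set S := \sum_(w <- words k.+1) f w *: c w; rewrite (eq_bigr (fun=> S)) => [|i _].
  by rewrite sumr_const card_ord scaler_nat.
rewrite /S -[RHS](big_words_rot _ _ i) big_seq [RHS]big_seq.
by apply: eq_bigr => w /size_words Hw; rewrite Hci // ltnW.
Qed.

(** A map respecting rotation of monomials in the trace descends to cyclic words: continuity leaves
    finitely many words, where [cyc_pairing] applies. *)
Lemma cyc_compat F f g : cont F ->
  (forall w, cyc (F (smono (rot 1 w))) = cyc (F (smono w))) ->
  cyc f = cyc g -> cyc (F f) = cyc (F g).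
Proof.
move=> cF HF Hfg; apply/eqP; rewrite -subr_eq0 -(cont_sub cont_cyc) -(cont_sub cF).
have H : cyc (f - g) = 0 by rewrite (cont_sub cont_cyc) Hfg subrr.
apply/eqP/sext => u; have cc := cont_comp cont_cyc cF.
have [m Hm] := cont_trunc cc (size u).+1.
rewrite (Hm m) // big1 // => k _.
have := @cyc_pairing rat^o k (fun w => cyc (F (smono w)) u) _ _ H; apply.
by move=> w _; rewrite HF.
Qed.

Lemma mem_rots u w : reflect (exists2 i, (i <= size w)%N & u = rot i w) (u \in rots w).
Proof.
rewrite /rots mem_undup; apply: (iffP mapP) => -[i].
  by rewrite mem_iota /= add0n ltnS; exists i.
by move=> Hi ->; exists i; rewrite // mem_iota /= add0n ltnS.
Qed.

Lemma rots_rot (V : nmodType) w (F : word -> V) :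
  \sum_(u <- rots w) F (rot 1 u) = \sum_(u <- rots w) F u.
Proof.
rewrite -(big_map (rot 1) predT F); apply: perm_big.
have U : uniq (map (rot 1) (rots w)).
  by rewrite map_inj_uniq ?undup_uniq //; exact: rot_inj.
have S : {subset map (rot 1) (rots w) <= rots w}.
  move=> u /mapP[v /mem_rots[i Hi ->] ->]; apply/mem_rots.
  move: Hi; rewrite leq_eqVlt => /orP[/eqP->|Hi].
    rewrite rot_size; case: (size w =P 0%N) => [/size0nil->|Hw]; first by exists 0%N.
    by exists 1%N => //; case: (size w) Hw.
  by exists i.+1 => //; rewrite (rotS Hi).
apply: uniq_perm => //; first exact: undup_uniq.
by have [] := uniq_min_size U S _; rewrite ?size_map.
Qed.

Lemma rots_roti (V : nmodType) w i (F : word -> V) : (i <= size w)%N ->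
  \sum_(u <- rots w) F (rot i u) = \sum_(u <- rots w) F u.
Proof.
elim: i F => [|i IH] F Hi; first by apply: eq_bigr => u _; rewrite rot0.
rewrite -[RHS]rots_rot -[RHS](IH (fun u => F (rot 1 u))) 1?ltnW //.
rewrite big_seq [RHS]big_seq; apply: eq_bigr => u /mem_rots[j _ ->].
by rewrite rotS // size_rot.
Qed.

(* Double counting of the sum of f (rot i u) over i and u in rots w. *)
Lemma rots_cyc f w : (0 < size w)%N ->
  (size w)%:R * \sum_(u <- rots w) f u = (size (rots w))%:R * cyc f w.
Proof.
move=> Hw; have -> : (size w)%:R * \sum_(u <- rots w) f u =
    \sum_(i < size w) \sum_(u <- rots w) f (rot i u).
  set S := \sum_(u <- rots w) f u; rewrite (eq_bigr (fun=> S)) => [|i _].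
    by rewrite sumr_const card_ord mulr_natl.
  by rewrite /S rots_roti // ltnW.
rewrite exchange_big /= big_seq (eq_bigr (fun=> cyc f w)) => [|u].
  by rewrite -big_seq big_const_seq count_predT iter_addr_0 mulr_natl.
move=> /mem_rots[i Hi ->].
have -> : cyc f w = cyc f (rot i w).
  elim: i Hi => [|i IH] Hi; first by rewrite rot0.
  by rewrite rotS // cyc_rot IH // ltnW.
rewrite /cyc; case E : (rot i w) (size_rot i w) Hw => [|b v] //= <- //.
Qed.

(** By [rots_cyc], the sum over distinct rotations and the sum over all rotations differ by a
    nonzero factor. *)
Lemma tr_eqP f g : tr_eq f g <-> cyc f = cyc g.
Proof.
have E w : \sum_(u <- rots w) (f u - g u) = \sum_(u <- rots w) (f - g) u by [].
have cE : (cyc f = cyc g) <-> cyc (f - g) = 0.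
  rewrite (cont_sub cont_cyc); split=> [->|/eqP]; first by rewrite subrr.
  by rewrite subr_eq0 => /eqP.
rewrite cE; split=> [H|H w].
  apply: sext => -[|b w].
    by have := H [::]; rewrite E /rots /= big_seq1.
  have := @rots_cyc (f - g) (b :: w) isT; rewrite -E H mulr0 => /esym/eqP.
  rewrite mulf_eq0 pnatr_eq0 => /orP[|/eqP//]; rewrite size_eq0 => /eqP R0.
  have : b :: w \in rots (b :: w) by apply/mem_rots; exists 0%N; rewrite ?rot0.
  by rewrite R0.
rewrite E; case: w => [|b w].
  by rewrite /rots /= big_seq1 -[LHS]/(cyc (f - g) [::]) H.
have := @rots_cyc (f - g) (b :: w) isT; rewrite H mulr0 => /eqP.
by rewrite mulf_eq0 pnatr_eq0 /= => /eqP.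
Qed.

(** * Fox derivatives and divergence *)

(** Right Fox derivative: [dR false f] and [dR true f] are the f_x and f_y of f = c + f_x x + f_y
    y. *)
Definition dR (b : bool) (f : series) : series := fun w => f (rcons w b).

Lemma cont_dR b : cont (dR b).
Proof.
split=> [c f g|n]; first by [].
by exists n.+1 => f Hf w Hw; apply: Hf; rewrite size_rcons ltnS.
Qed.

Lemma dR_letter b c f : dR b (f * letter c) = if b == c then f else 0.
Proof.
apply: sext => w; rewrite /dR mul_letter; case: eqP => _; first by rewrite mul1r.
by rewrite mul0r.
Qed.
Lemma dR_X b f : dR b (f * sX) = if b then 0 else f.
Proof. by rewrite dR_letter; case: b. Qed.
Lemma dR_Y b f : dR b (f * sY) = if b then f else 0.
Proof. by rewrite dR_letter; case: b. Qed.

Lemma dR1 b : dR b 1 = 0.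
Proof. by apply: sext => w; rewrite /dR one_at; case: w. Qed.

Lemma dR_decomp f : f = f [::] *: 1 + dR false f * sX + dR true f * sY.
Proof.
apply: sext => w; case/lastP: w => [|w b].
  by rewrite !at_ one_at !mul_letter_nil !addr0 mulr1.
rewrite !at_ one_at !mul_letter /dR; have -> : (rcons w b == [::]) = false by case: w.
by case: b; rewrite /= !(mulr0, mul0r, mul1r, add0r, addr0).
Qed.

Lemma dRM b (f g : series) : dR b (f * g) = f * dR b g + g [::] *: dR b f.
Proof.
rewrite {1}(dR_decomp g) !mulrDr !(cont_add (cont_dR b)) !mulrA dR_X dR_Y.
rewrite -scalerAr mulr1 (cont_scale (cont_dR b)) -addrA addrC; congr (_ + _).
by case: b; rewrite ?addr0 ?add0r.
Qed.

Lemma dRM0 b (f g : series) : g [::] = 0 -> dR b (f * g) = f * dR b g.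
Proof. by move=> g0; rewrite dRM g0 scale0r addr0. Qed.

Lemma xpartE f : xpart f = dR false f * sX.
Proof.
apply: sext => w; case/lastP: w => [|w b]; first by rewrite mul_letter_nil.
rewrite mul_letter /xpart /dR size_rcons last_rcons /=.
by case: b; rewrite ?mul0r ?mul1r.
Qed.
Lemma ypartE f : ypart f = dR true f * sY.
Proof.
apply: sext => w; case/lastP: w => [|w b]; first by rewrite mul_letter_nil.
rewrite mul_letter /ypart /dR size_rcons last_rcons /=.
by case: b; rewrite ?mul0r ?mul1r.
Qed.

Lemma part_decomp (f : series) : f [::] = 0 -> f = dR false f * sX + dR true f * sY.
Proof. by move=> f0; rewrite {1}(dR_decomp f) f0 scale0r add0r. Qed.

Lemma dR_der fx fy f b : fx [::] = 0 -> fy [::] = 0 ->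
  dR b (der fx fy f) =
    der fx fy (dR b f) + dR false f * dR b fx + dR true f * dR b fy.
Proof.
move=> x0 y0; rewrite {1}(dR_decomp f) !(cont_add (cont_der _ _)) (cont_scale (cont_der _ _)).
rewrite der1 // scaler0 add0r !derM // derX // derY // !(cont_add (cont_dR b)).
rewrite dR_X dR_Y !dRM0 //.
by case: b; rewrite ?add0r ?addr0 ?addrA //; apply: sext => w; rewrite !at_; ring.
Qed.

(** Fox's chain rule, from substituting in f = c + f_x x + f_y y. *)
Lemma dR_subst p q f b : p [::] = 0 -> q [::] = 0 ->
  dR b (subst p q f) =
    subst p q (dR false f) * dR b p + subst p q (dR true f) * dR b q.
Proof.
move=> p0 q0; rewrite {1}(dR_decomp f) !(cont_add (cont_subst _ _)) (cont_scale (cont_subst _ _)).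
by rewrite subst1 // !substM // substX // substY // !(cont_add (cont_dR b)) !dRM0 //
  (cont_scale (cont_dR b)) dR1 scaler0 add0r.
Qed.

Lemma cyc_der_compat fx fy f g : fx [::] = 0 -> fy [::] = 0 ->
  cyc f = cyc g -> cyc (der fx fy f) = cyc (der fx fy g).
Proof.
move=> x0 y0; apply: cyc_compat; first exact: cont_der.
case=> [|b w] //; rewrite rot1_cons smono_rcons (smono_cons b w) !derM //.
by rewrite !(cont_add cont_cyc) cycM [X in _ + X]cycM addrC.
Qed.

Lemma cyc_subst_compat p q f g : p [::] = 0 -> q [::] = 0 ->
  cyc f = cyc g -> cyc (subst p q f) = cyc (subst p q g).
Proof.
move=> p0 q0; apply: cyc_compat; first exact: cont_subst.
by case=> [|b w] //; rewrite rot1_cons smono_rcons (smono_cons b w) !substM // cycM.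
Qed.

(** Brackets vanish in the trace, so only weight one could contribute, and the hypotheses exclude
    it. *)
Lemma lie_2_cyc f : lie_2 f -> f [:: false] = 0 -> f [:: true] = 0 -> cyc f = 0.
Proof.
move=> Hf fx fy.
have H n : forall g, lie_span (fun g => g = sX \/ g = sY) g -> (1 < n)%N ->
    forall w, size w = n -> cyc g w = 0.
  move=> g; elim=> [h [->|->] Hn [|b w] // Hw|h k _ Hh _ Hk Hn w Hw|c h _ Hh Hn w Hw|h k _ _ _ _ Hn w Hw].
  - rewrite /cyc big1 // => i _; rewrite /sX smonoE; case: eqP => // /(congr1 size).
    by rewrite size_rot Hw => E; move: Hn; rewrite E.
  - rewrite /cyc big1 // => i _; rewrite /sY smonoE; case: eqP => // /(congr1 size).
    by rewrite size_rot Hw => E; move: Hn; rewrite E.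
  - by rewrite saddE (cont_add cont_cyc) !at_ Hh ?Hk ?addr0.
  - by rewrite sscaleE (cont_scale cont_cyc) !at_ Hh ?mulr0.
  by rewrite sbrE cyc_commutator.
apply: sext => -[|b [|c w]].
- exact: (lie_2_nil Hf).
- by rewrite /cyc big_ord1 rot0; case: b.
transitivity (cyc (hcomp (size w).+2 f) [:: b, c & w]).
  by rewrite /cyc; apply: eq_bigr => i _; rewrite /hcomp size_rot eqxx.
by rewrite (H (size w).+2).
Qed.

(** * The divergence of a special derivation and of its elliptic image *)

Definition Jx : series := xser cJ.
Definition Kx : series := xser cK.

Lemma JKx : Jx * Kx = 1.
Proof.
rewrite /Jx /Kx xserM -xser_delta0; apply: sext => w.
by rewrite /xser; case: ifP => // _; apply: convJK.
Qed.
Lemma KJx : Kx * Jx = 1.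
Proof.
rewrite /Jx /Kx xserM -xser_delta0; apply: sext => w.
by rewrite /xser; case: ifP => // _; rewrite conv_comm convJK.
Qed.

Lemma dRx_ex : dR false ex = Jx.
Proof.
apply: sext => w; rewrite /dR /ex /Jx /xser all_rcons size_rcons /=.
by case: ifP.
Qed.
Lemma dRy_ex : dR true ex = 0.
Proof. by apply: sext => w; rewrite /dR /ex /xser all_rcons. Qed.

(** The only word of (ad x)^k(y) ending in y is x^k y. *)
Lemma dRy_px : dR true px = - Kx.
Proof.
rewrite /px (cont_opp (cont_dR _)); congr (- _); apply: sext => w.
have E k : dR true (iter k adx sY) = sX ^+ k.
  elim: k => [|k IH] /=.
    by rewrite -[sY]mul1r dR_Y.
  rewrite /adx (cont_sub (cont_dR _)) dR_X subr0 dRM IH exprS.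
  rewrite [X in _ + _ *: X](_ : _ = 0) ?scaler0 ?addr0 //.
  by rewrite -[sX]mul1r dR_X.
rewrite /dR /Kx xser_ssum (ssumE (@xser_summable _) (N := (size w).+2)) //.
rewrite /act (ssumE (@act_summable _ _) (N := (size w).+2)) ?size_rcons //.
by apply: eq_bigr => k _; rewrite !at_ -E.
Qed.

(** Fox derivative of q e = - e p; the constant term 1 of e isolates the derivative of q. *)
Lemma dR_py b : dR b py = - (ex * dR b px) - py * dR b ex.
Proof.
have := congr1 (dR b) py_ex; rewrite (cont_opp (cont_dR b)) dRM ex_nil scale1r dRM0 ?px_nil //.
by move=> <-; rewrite addrC addKr.
Qed.

Lemma ell_nil f : ell_subst f [::] = f [::].
Proof. exact: subst_nil. Qed.
Lemma cyc_ell f g : cyc f = cyc g -> cyc (ell_subst f) = cyc (ell_subst g).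
Proof. exact: (cyc_subst_compat px_nil py_nil). Qed.
Lemma dR_ell b f :
  dR b (ell_subst f) = ell_subst (dR false f) * dR b px + ell_subst (dR true f) * dR b py.
Proof. exact: (dR_subst _ _ px_nil py_nil). Qed.

(** The ring identity behind [gamma_div], with every series replaced by a variable: [x], [p], [y]
    stand for e, p, q, [P] for the x-derivative of p, [u], [v] for alpha, beta, [a], [b] for the
    images of a_y, b_y, and [A], [B] for the images of a_x, b_x minus [a] e, [b] e. *)
Lemma div_expansion (K J P p x A B a b y u v DJ DK : series) :
  K * (x * (A * P - a * y * J) - v * J - (B * P - b * y * J) - DJ) +
  J * (P * (K * (x * - (A * K) - - (B * K))) - DK - p * - (A * K) - u * K) =
  (K * (x * A - B) * P - J * P * K * (x * A - B) * K)
   - K * (x * a * y) * J - K * v * J + K * (b * y) * J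
   - (K * DJ + J * DK) + J * (p * A) * K - J * u * K.
Proof.
rewrite !(mulrDl, mulrDr, mulNr, mulrN, opprD, opprK, mulrA).
by apply: sext => w; rewrite !at_; ring.
Qed.

Section EllipticDivergence.
Variable e : series * series.
Hypothesis He : sder2 e.
Hypothesis He1 : e.1 [:: true] = 0.
Hypothesis He2 : e.2 [:: false] = 0.
Local Notation a := (e.1).
Local Notation b := (e.2).
Local Notation alpha := (ell_subst a).
Local Notation beta := (ell_subst b).
Local Notation B := (gamma e).
Local Notation C := (gamma_y e).
Local Notation D := (der B C).

(* The divergence is computed in the coordinates (px, ex), whose Fox Jacobian
   [[dR x px, - Kx], [Jx, 0]] has inverse [[0, Kx], [- Jx, Jx (dR x px) Kx]]. *)
Lemma gamma_div : cyc (dR false B + dR true C) = cyc (ell_subst (xpart a + ypart b)).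
Proof.
have [Ha [Hb [a1 [b1 _]]]] := He.
have a0 : alpha [::] = 0 by rewrite ell_nil lie_2_nil.
have b0 : beta [::] = 0 by rewrite ell_nil lie_2_nil.
have ca : cyc alpha = 0.
  rewrite -(cont0 cont_cyc) -(cont0 cont_ell).
  by apply: cyc_ell; rewrite (cont0 cont_cyc) lie_2_cyc.
have cb : cyc beta = 0.
  rewrite -(cont0 cont_cyc) -(cont0 cont_ell).
  by apply: cyc_ell; rewrite (cont0 cont_cyc) lie_2_cyc.
pose P := dR false px; pose ap := ell_subst (dR false a); pose aq := ell_subst (dR true a).
pose bp := ell_subst (dR false b); pose bq := ell_subst (dR true b).
have B0 := gamma_nil He; have C0 := gamma_y_nil He.
pose A1 := ap - aq * ex; pose B1 := bp - bq * ex.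
have dxa : dR false alpha = A1 * P - aq * py * Jx.
  rewrite dR_ell dR_py dRx_ex mulrBr [_ * - (ex * _)]mulrN.
  by rewrite addrA /A1 mulrBl !mulrA.
have dxb : dR false beta = B1 * P - bq * py * Jx.
  rewrite dR_ell dR_py dRx_ex mulrBr [_ * - (ex * _)]mulrN.
  by rewrite addrA /B1 mulrBl !mulrA.
have dya : dR true alpha = - (A1 * Kx).
  rewrite dR_ell dR_py dRy_ex dRy_px mulr0 subr0.
  by rewrite !mulrN opprK /A1 mulrBl opprB mulrA [LHS]addrC.
have dyb : dR true beta = - (B1 * Kx).
  rewrite dR_ell dR_py dRy_ex dRy_px mulr0 subr0.
  by rewrite !mulrN opprK /B1 mulrBl opprB mulrA [LHS]addrC.
have dxe : Jx * dR false B = ex * dR false alpha - beta * Jx - dR false beta - D Jx.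
  have := congr1 (dR false) (D_ex He); rewrite dR_der // dRx_ex dRy_ex mul0r addr0.
  rewrite (cont_sub (cont_dR _)) dRM0 // dRM ex_nil scale1r dRx_ex.
  by move=> H; apply: sext => w; move/(congr1 (fun g : series => g w)): H; rewrite !at_ => H; lra.
have dye : Jx * dR true B = ex * dR true alpha - dR true beta.
  have := congr1 (dR true) (D_ex He); rewrite dR_der // dRx_ex dRy_ex mul0r addr0.
  rewrite (cont0 (cont_D e)) add0r (cont_sub (cont_dR _)) dRM0 // dRM ex_nil scale1r dRy_ex.
  by rewrite mulr0 add0r.
have dyp : Kx * dR true C = P * dR true B - D Kx - px * dR true alpha - alpha * Kx.
  have := congr1 (dR true) (D_px He); rewrite dR_der // dRy_px.
  rewrite (cont_sub (cont_dR _)) !dRM0 ?px_nil // dRy_px (cont_opp (cont_D e)) [alpha * - Kx]mulrN [- Kx * _]mulNr -/P.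
  by move=> H; apply: sext => w; move/(congr1 (fun g : series => g w)): H; rewrite !at_ => H; lra.
have dB z : dR z B = Kx * (Jx * dR z B) by rewrite mulrA KJx mul1r.
have dC : dR true C = Jx * (Kx * dR true C) by rewrite mulrA JKx mul1r.
(* D(J K) = D 1 = 0: here the logarithmic trace of the Jacobian drops out. *)
have DJK : D Jx * Kx + Jx * D Kx = 0 by rewrite -(DM He) JKx der1.
(* Cyclicity with J K = K J = 1 identifies the two terms containing [P], which carry opposite
   signs. *)
have h1 M : cyc (Jx * P * Kx * M * Kx) = cyc (Kx * M * P).
  by rewrite cycM !mulrA KJx mul1r -[P * Kx * M]mulrA cycM.
have h2 M : cyc (Kx * M * Jx) = cyc M by rewrite cycM !mulrA JKx mul1r.
have h3 M : cyc (Jx * M * Kx) = cyc M by rewrite cycM !mulrA KJx mul1r.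
(* By q e = - e p the two terms in [aq] cancel, leaving only the x-part of a. *)
have h4 : cyc (ex * aq * py) = - cyc (px * aq * ex).
  rewrite -mulrA cycM -mulrA py_ex mulrN (cont_opp cont_cyc); congr (- _).
  by rewrite mulrA [LHS]cycM mulrA.
have E : dR false B + dR true C =
   (Kx * (ex * A1 - B1) * P - Jx * P * Kx * (ex * A1 - B1) * Kx)
   - Kx * (ex * aq * py) * Jx - Kx * beta * Jx + Kx * (bq * py) * Jx
   - (Kx * D Jx + Jx * D Kx) + Jx * (px * A1) * Kx - Jx * alpha * Kx.
  rewrite dB dxe dC dyp dB dye dxa dxb dya dyb.
  exact: div_expansion.
rewrite E !(cont_add cont_cyc, cont_opp cont_cyc) h1 subrr add0r !h2 !h3 ca cb.
rewrite [cyc (Kx * _)]cycM -(cont_add cont_cyc) DJK (cont0 cont_cyc) oppr0 !addr0.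
rewrite h4 opprK /A1 mulrBr (cont_sub cont_cyc) mulrA.
rewrite xpartE ypartE (cont_add cont_ell) !ellM ellX ellY (cont_add cont_cyc).
rewrite [cyc (px * ap)]cycM; apply: sext => w; rewrite !at_; ring.
Qed.
End EllipticDivergence.

(** * The bracket and the divergence condition on krv *)

Lemma sbr_nil f g : sbr f g [::] = 0.
Proof. by rewrite sbrE sub_at !mul_nil mulrC subrr. Qed.

Lemma cont_Eop e : cont (Eop e). Proof. exact: cont_der. Qed.
Lemma EopM e f g : Eop e (f * g) = Eop e f * g + f * Eop e g.
Proof. by apply: derM; apply: sbr_nil. Qed.
Lemma EopX e : Eop e sX = sX * e.1 - e.1 * sX.
Proof. by apply: derX; apply: sbr_nil. Qed.
Lemma EopY e : Eop e sY = sY * e.2 - e.2 * sY.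
Proof. by apply: derY; apply: sbr_nil. Qed.

Lemma Eop_br e e' f : Eop (sder_br e e') f = Eop e (Eop e' f) - Eop e' (Eop e f).
Proof.
apply: esym; move: f; apply: der_unique; try exact: sbr_nil.
- by apply: contB; apply: cont_comp; apply: cont_Eop.
- exact: (comm_Leibniz (cont_Eop e) (cont_Eop e') (EopM e) (EopM e')).
- rewrite !EopX !(cont_sub (cont_Eop _)) !EopM !EopX sbrE /=.
  rewrite !(mulrDl, mulrDr, mulNr, mulrN, opprD, opprK, mulrA).
  by apply: sext => w; rewrite !at_; ring.
- rewrite !EopY !(cont_sub (cont_Eop _)) !EopM !EopY sbrE /=.
  rewrite !(mulrDl, mulrDr, mulNr, mulrN, opprD, opprK, mulrA).
  by apply: sext => w; rewrite !at_; ring.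
Qed.

Lemma Eop_xy e : sder2 e -> Eop e (sX + sY) = 0.
Proof.
move=> [_ [_ [_ [_ H]]]]; rewrite (cont_add (cont_Eop e)) EopX EopY.
by rewrite -[LHS]/(sadd (sbr sX e.1) (sbr sY e.2)) H.
Qed.

Lemma lie_2_letter b : lie_2 (letter b).
Proof.
by apply: (span_LC genXY_hom genXY_inh); apply: ls_gen; case: b; [right|left].
Qed.

Lemma lie_2_Eop e f : lie_2 e.1 -> lie_2 e.2 -> lie_2 f -> lie_2 (Eop e f).
Proof.
move=> H1 H2; apply: lie_2_der; try exact: sbr_nil.
- exact: (LC_br genXY_inh (lie_2_letter false) H1).
- exact: (LC_br genXY_inh (lie_2_letter true) H2).
Qed.

Lemma sder2_br e e' : sder2 e -> sder2 e' ->
  vord 2 (sder_br e e').1 -> vord 2 (sder_br e e').2 -> sder2 (sder_br e e').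
Proof.
move=> He He' v1 v2; have [Ha [Hb _]] := He; have [Ha' [Hb' _]] := He'.
split; [|split; [|split; [|split]]].
- apply: (LCB (G := genXY)); last exact: lie_2_Eop.
  by apply: (LCD (G := genXY)); [exact: (LC_br genXY_inh)|exact: lie_2_Eop].
- apply: (LCB (G := genXY)); last exact: lie_2_Eop.
  by apply: (LCD (G := genXY)); [exact: (LC_br genXY_inh)|exact: lie_2_Eop].
- exact: v1.
- exact: v2.
rewrite saddE !sbrE -EopX -EopY -(cont_add (cont_Eop _)) Eop_br !Eop_xy //.
by rewrite !(cont0 (cont_Eop _)) subrr.
Qed.

Lemma dR_brX c (f : series) : f [::] = 0 ->
  dR c (sX * f - f * sX) = sX * dR c f - (if c then 0 else f).
Proof. by move=> f0; rewrite (cont_sub (cont_dR _)) dRM0 // dR_X. Qed.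
Lemma dR_brY c (f : series) : f [::] = 0 ->
  dR c (sY * f - f * sY) = sY * dR c f - (if c then f else 0).
Proof. by move=> f0; rewrite (cont_sub (cont_dR _)) dRM0 // dR_Y. Qed.

(** Taking the part of a series on words ending in x commutes with E up to two products, which are
    absorbed into commutators in [cyc_div_br]. *)
Lemma div_Eop_x e f : e.1 [::] = 0 -> e.2 [::] = 0 ->
  dR false (Eop e f) * sX = Eop e (dR false f * sX)
    - dR false f * sX * (dR true e.1 * sY) + dR true f * sY * (dR false e.2 * sX).
Proof.
move=> a0 b0; rewrite EopM EopX /Eop dR_der ?sbr_nil // !sbrE.
rewrite dR_brX // dR_brY // ?subr0.
have H : dR false f * sX * e.1 =
    dR false f * sX * (dR false e.1 * sX) + dR false f * sX * (dR true e.1 * sY).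
  by rewrite -mulrDr -part_decomp.
rewrite !(mulrDl, mulrDr, mulNr, mulrN, mulrA, subr0) H !mulrA.
by apply: sext => w; rewrite !at_; ring.
Qed.

Lemma div_Eop_y e f : e.1 [::] = 0 -> e.2 [::] = 0 ->
  dR true (Eop e f) * sY = Eop e (dR true f * sY)
    - dR true f * sY * (dR false e.2 * sX) + dR false f * sX * (dR true e.1 * sY).
Proof.
move=> a0 b0; rewrite EopM EopY /Eop dR_der ?sbr_nil // !sbrE.
rewrite dR_brX // dR_brY // ?subr0.
have H : dR true f * sY * e.2 =
    dR true f * sY * (dR false e.2 * sX) + dR true f * sY * (dR true e.2 * sY).
  by rewrite -mulrDr -part_decomp.
rewrite !(mulrDl, mulrDr, mulNr, mulrN, mulrA, subr0) H !mulrA.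
by apply: sext => w; rewrite !at_; ring.
Qed.

Definition pair_div (e : series * series) : series := dR false e.1 * sX + dR true e.2 * sY.

Lemma pair_divE e : sadd (xpart e.1) (ypart e.2) = pair_div e.
Proof. by rewrite saddE xpartE ypartE. Qed.

(** Cocycle property of the divergence; it uses only the absence of constant terms. *)
Lemma cyc_div_br (e e' : series * series) : e.1 [::] = 0 -> e.2 [::] = 0 -> e'.1 [::] = 0 -> e'.2 [::] = 0 ->
  cyc (pair_div (sder_br e e')) = cyc (Eop e (pair_div e') - Eop e' (pair_div e)).
Proof.
move=> a0 b0 a0' b0'; apply/eqP; rewrite -subr_eq0 -(cont_sub cont_cyc).
set u1 := dR false e.1 * sX; set u2 := dR true e.1 * sY.
set v1 := dR false e.2 * sX; set v2 := dR true e.2 * sY.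
set u1' := dR false e'.1 * sX; set u2' := dR true e'.1 * sY.
set v1' := dR false e'.2 * sX; set v2' := dR true e'.2 * sY.
have Ea : e.1 = u1 + u2 by exact: part_decomp.
have Eb : e.2 = v1 + v2 by exact: part_decomp.
have Ea' : e'.1 = u1' + u2' by exact: part_decomp.
have Eb' : e'.2 = v1' + v2' by exact: part_decomp.
(* The defect is an explicit sum of eight commutators between the x- and y-parts of the four
   series. *)
rewrite (_ : _ - _ = (u2 * u1' - u1' * u2) + (u2' * v1 - v1 * u2') + (v1 * v2' - v2' * v1)
  + (v1' * u2 - u2 * v1') + (u1 * u2' - u2' * u1) + (v2 * v1' - v1' * v2)
  + (u1 * u1' - u1' * u1) + (v2 * v2' - v2' * v2)).
  by rewrite 7!(cont_add cont_cyc) !cyc_commutator !addr0.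
rewrite /pair_div /sder_br /= !(cont_sub (cont_dR _)) !(cont_add (cont_dR _)).
rewrite !(cont_opp (cont_dR _)) !dRM0 // !(cont_add (cont_Eop _)) !mulrBl !mulrDl !mulNr.
rewrite !div_Eop_x // !div_Eop_y // -/u1 -/u2 -/v1 -/v2 -/u1' -/u2' -/v1' -/v2' -!mulrA.
rewrite -/u1 -/v2 -/u1' -/v2'.
have E1 : e.1 * u1' = u1 * u1' + u2 * u1' by rewrite {1}Ea mulrDl.
have E2 : e'.1 * u1 = u1' * u1 + u2' * u1 by rewrite {1}Ea' mulrDl.
have E3 : e.2 * v2' = v1 * v2' + v2 * v2' by rewrite {1}Eb mulrDl.
have E4 : e'.2 * v2 = v1' * v2 + v2' * v2 by rewrite {1}Eb' mulrDl.
rewrite E1 E2 E3 E4 /u1 /u2 /v1 /v2 /u1' /u2' /v1' /v2' !mulrA.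
by apply: sext => w; rewrite !at_; ring.
Qed.

(** [hterm] reads h from degree 2 on; the cut turns it into a convergent sum over all degrees. *)
Definition hcut (h : nat -> rat) : nat -> rat := fun k => if (2 <= k)%N then h k else 0.

Lemma sXY_expE k w : ((sX + sY) ^+ k) w = (size w == k)%:R.
Proof.
elim: k w => [|k IH] w; first by rewrite expr0 one_at; case: w.
rewrite exprS mulrDl at_; case: w => [|b w]; last first.
  by rewrite sX_cons sY_cons !IH; case: b; rewrite /= mul0r mul1r ?add0r ?addr0 eqSS.
by rewrite !mul_nil /sX /sY !smonoE !mul0r addr0.
Qed.

Lemma sY_expE k w : (sY ^+ k) w = (w == nseq k true)%:R.
Proof.
elim: k w => [|k IH] w; first by rewrite expr0 one_at.
rewrite exprS letter_mul; case: w => [|b w] //; rewrite IH -natrM mulnb.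
by rewrite eqseq_cons.
Qed.

Lemma hterm_summable h :
  summable (fun k => hcut h k *: ((sX + sY) ^+ k - sX ^+ k - sY ^+ k)).
Proof.
have H b : vord 1 (letter b) by exact: vord_smono.
move=> k; apply/vordZ/vordB; first apply/vordB; apply: expr_ord; try exact: H.
by apply: vordD; apply: H.
Qed.

Lemma htermE h : hterm h = ssum (fun k => hcut h k *: ((sX + sY) ^+ k - sX ^+ k - sY ^+ k)).
Proof.
apply: sext => w; rewrite /ssum big_ord_recr big1 /= => [|k _]; last first.
  have Hk := ltn_ord k; rewrite !at_ sXY_expE sX_expE sY_expE.
  have E (b : bool) : w == nseq k b = false.
    by apply/eqP => E; move: Hk; rewrite {2}E size_nseq ltnn.
  by rewrite !E gtn_eqF // !subr0 mulr0.
rewrite add0r !at_ sXY_expE sX_expE sY_expE eqxx /hterm /hcut.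
have Ex : (w == nseq (size w) false) = all negb w.
  by elim: w => //= b w <-; rewrite eqseq_cons; case: b.
have Ey : (w == nseq (size w) true) = all id w.
  by elim: w {Ex} => //= b w <-; rewrite eqseq_cons; case: b.
rewrite Ex Ey; case: ifP => _; last by rewrite mul0r.
by case: all; case: all.
Qed.

Lemma cyc_der_exp D z : cont D -> (forall f g, D (f * g) = D f * g + f * D g) ->
  (forall m, cyc (z ^+ m * D z) = 0) -> forall k, cyc (D (z ^+ k)) = 0.
Proof.
move=> cD LD Hz k; rewrite -[D _]mul1r -(expr0 z); elim: k 0%N => [|k IH] j.
  by rewrite (Leibniz_one LD) mulr0 (cont0 cont_cyc).
rewrite exprS LD mulrDr (cont_add cont_cyc) [_ * (z * _)]mulrA -exprSr IH addr0.
by rewrite mulrA cycM mulrA -exprD Hz.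
Qed.

(** x + y is killed, while x and y go to [x, a] and [y, b], whose products with powers of x,
    respectively y, have trace 0. *)
Lemma cyc_Eop_hterm e h : sder2 e -> cyc (Eop e (hterm h)) = 0.
Proof.
move=> He; rewrite htermE (ssum_cont (@hterm_summable h) (cont_Eop e) (@slocal_der _ _)).
have Hxy : Eop e (sX + sY) = 0 by exact: Eop_xy.
have H b f m : cyc (letter b ^+ m * (letter b * f - f * letter b)) = 0.
  by rewrite mulrBr (cont_sub cont_cyc) !mulrA -exprSr [X in _ - X]cycM mulrA -exprS subrr.
have Hs : summable (fun k => Eop e (hcut h k *: ((sX + sY) ^+ k - sX ^+ k - sY ^+ k))).
  by move=> k; apply: slocal_der; apply: hterm_summable.
rewrite (ssum_cont Hs cont_cyc slocal_cyc); apply: sext => w; rewrite /ssum big1 // => k _.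
rewrite (cont_scale (cont_Eop e)) !(cont_sub (cont_Eop e)) (cont_scale cont_cyc).
rewrite !(cont_sub cont_cyc) !(cyc_der_exp (cont_Eop e) (EopM e)) ?subr0 ?scaler0 // => m.
- by rewrite EopY H.
- by rewrite EopX H.
- by rewrite Hxy mulr0 (cont0 cont_cyc).
Qed.

Lemma krv_sder e : krv e -> sder2 e. Proof. by case. Qed.
Lemma krv_vord e : krv e -> vord 3 e.1 /\ vord 3 e.2.
Proof. by case=> _ [_ H]; split=> w /H[]. Qed.
Lemma krv_nil e : krv e -> e.1 [::] = 0 /\ e.2 [::] = 0.
Proof. by case=> _ [_ H]; apply: H. Qed.
Lemma krv_cyc e : krv e -> exists h, cyc (pair_div e) = cyc (hterm h).
Proof. by case=> _ [[h /tr_eqP Hh] _]; exists h; rewrite -pair_divE. Qed.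

Lemma krv_br e e' : krv e -> krv e' -> krv (sder_br e e').
Proof.
move=> He He'; have [va vb] := krv_vord He; have [va' vb'] := krv_vord He'.
have [a0 b0] := krv_nil He; have [a0' b0'] := krv_nil He'.
have v1 : vord 3 (sder_br e e').1.
  apply: vordB; last by apply: slocal_der.
  apply: vordD; last by apply: slocal_der.
  by apply: vordB; apply: vordMr.
have v2 : vord 3 (sder_br e e').2.
  apply: vordB; last by apply: slocal_der.
  apply: vordD; last by apply: slocal_der.
  by apply: vordB; apply: vordMr.
split; first by apply: sder2_br; [exact: krv_sder|exact: krv_sder|exact: vord_le v1|exact: vord_le v2].
split; last by move=> w Hw; split; [apply: v1|apply: v2].
(* Both terms given by the cocycle property vanish by [cyc_Eop_hterm], so the bracket has h = 0. *)
exists (fun=> 0); apply/tr_eqP; rewrite pair_divE cyc_div_br // (cont_sub cont_cyc).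
have [h Hh] := krv_cyc He; have [h' Hh'] := krv_cyc He'.
rewrite (cyc_der_compat _ _ Hh') ?sbr_nil // (cyc_der_compat _ _ Hh) ?sbr_nil //.
rewrite -!/(Eop _ _) (cyc_Eop_hterm h' (krv_sder He)) (cyc_Eop_hterm h (krv_sder He')) subrr.
rewrite -(cont0 cont_cyc); congr cyc; apply: sext => w; rewrite /hterm mul0r.
by case: ifP.
Qed.

(** Reversal of words is an anti-automorphism fixing x and y, so each bracket changes sign once. *)
Lemma lie_2_rev f w : lie_2 f -> f (rev w) = (-1) ^+ (size w).+1 * f w.
Proof.
move=> Hf; have E u : f u = hcomp (size u) f u by rewrite /hcomp eqxx.
rewrite E (E w) size_rev; move: (hcomp _ f) (Hf (size w)) => f' Hf'.
elim: Hf' w {E} => [g [->|->]|g h _ Hg _ Hh|c g _ Hg|g h _ Hg _ Hh] w.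
- rewrite /sX !smonoE; case: w => [|b [|c w]]; rewrite ?mulr0 //.
    by rewrite sqrrN expr1n mul1r.
  rewrite eqseq_cons andbF mulr0; case: eqP => // /(congr1 size).
  by rewrite size_rev.
- rewrite /sY !smonoE; case: w => [|b [|c w]]; rewrite ?mulr0 //.
    by rewrite sqrrN expr1n mul1r.
  rewrite eqseq_cons andbF mulr0; case: eqP => // /(congr1 size).
  by rewrite size_rev.
- by rewrite saddE !at_ Hg Hh mulrDr.
- by rewrite sscaleE !at_ Hg mulrCA.
have H (p q : series) : (forall w, p (rev w) = (-1) ^+ (size w).+1 * p w) ->
    (forall w, q (rev w) = (-1) ^+ (size w).+1 * q w) ->
    (p * q : series) (rev w) = (-1) ^+ (size w) * (q * p : series) w.
  move=> Hp Hq; rewrite !mul_at size_rev (reindex_inj rev_ord_inj) mulr_sumr.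
  apply: eq_bigr => i _ /=; have Hi : (i <= size w)%N by rewrite -ltnS ltn_ord.
  rewrite subSS take_rev drop_rev subKn // Hp Hq size_drop size_takel // mulrACA -exprD.
  have -> : ((size w - i).+1 + i.+1 = (size w).+2)%N by lia.
  by rewrite !exprS !mulN1r opprK [q _ * _]mulrC.
rewrite sbrE !sub_at !H // exprS mulN1r mulNr mulrBr opprB; congr (_ - _).
Qed.

(** In [x, a] + [y, b] = 0 the coefficient of x^(i+1) y gives a(x^i y) = 0, and that of x^(i+1) y
    x^(j+1) gives a(x^i y x^(j+1)) = a(x^(i+1) y x^j). *)
Lemma krv_depth1_left e i j : krv e -> e.1 (nseq i false ++ true :: nseq j false) = 0.
Proof.
move=> He; have [[Ha [Hb [a1 [b1 H]]]] _] := He; have [_ vb] := krv_vord He.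
have xb : xfree e.2 by apply: lie_2_xfree => //; apply: vb.
have E w : (sX * e.1 - e.1 * sX + (sY * e.2 - e.2 * sY)) w = 0.
  by rewrite -[LHS]/(sadd (sbr sX e.1) (sbr sY e.2) w) H.
have rc (u : word) b m : rcons (u ++ b :: nseq m false) false = u ++ b :: nseq m.+1 false.
  by rewrite rcons_cat /= -cats1 -[[:: false]]/(nseq 1 false) -nseqD addn1.
elim: j i => [|j IH] i.
  have := E (rcons (false :: nseq i false) true).
  rewrite !at_ !mul_letter rcons_cons sX_cons sY_cons cats1 /=.
  by rewrite -[false :: nseq i false]/(nseq i.+1 false) xb; lra.
have := E (rcons (false :: nseq i false ++ true :: nseq j false) false).
rewrite !at_ !mul_letter rcons_cons sX_cons sY_cons rc /=.
by have := IH i.+1 => /= ->; lra.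
Qed.

(** This is the coefficient of y x^m y in [x, a] + [y, b] = 0. *)
Lemma krv_depth1_sym e m : krv e ->
  e.2 (rcons (nseq m false) true) = e.2 (true :: nseq m false).
Proof.
move=> He; have [[Ha [Hb [a1 [b1 H]]]] _] := He.
have E w : (sX * e.1 - e.1 * sX + (sY * e.2 - e.2 * sY)) w = 0.
  by rewrite -[LHS]/(sadd (sbr sX e.1) (sbr sY e.2) w) H.
have := E (rcons (true :: nseq m false) true).
by rewrite !at_ !mul_letter rcons_cons sX_cons sY_cons /=; lra.
Qed.

(** Evaluate the trace on the cyclic word of x^(k-1) y. In depth one a contributes nothing and b
    only its coefficient on x^(k-1) y, which the symmetry and the sign under reversal force to 0 for
    even k; the other side is k h_k. *)
Lemma krv_h_even e h : krv e -> cyc (pair_div e) = cyc (hterm h) ->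
  forall k, ~~ odd k -> hcut h k = 0.
Proof.
move=> He Hh k; rewrite /hcut; case: k => [|[|m]] //= ; rewrite negbK => om.
have Hb : e.2 (rcons (nseq m.+1 false) true) = 0.
  have [[_ [Lb _]] _] := He.
  have := lie_2_rev (rcons (nseq m.+1 false) true) Lb.
  rewrite rev_rcons rev_nseq -krv_depth1_sym // size_rcons size_nseq.
  by rewrite -signr_odd /= negbK (negbTE om) /= expr1 mulN1r; lra.
set w := rcons (nseq m.+1 false) true in Hb.
have Hrot i : (i < m.+2)%N -> rot i w = nseq (m.+1 - i) false ++ true :: nseq i false.
  move=> Hi; rewrite /w -cats1 /rot drop_cat take_cat size_nseq.
  case: ltnP => Hi'; first by rewrite drop_nseq take_nseq 1?ltnW // -catA.
  have -> : i = m.+1 by lia.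
  by rewrite subnn /= cats0.
have := congr1 (fun g : series => g w) Hh.
have Hw : size w = m.+2 by rewrite size_rcons size_nseq.
have cycE (g : series) : cyc g w = \sum_(i < m.+2) g (rot i w) by rewrite /cyc -Hw; case: (w) Hw.
rewrite !cycE big1 => [|i _].
  rewrite (eq_bigr (fun=> h m.+2)) => [|i _].
    rewrite sumr_const card_ord => /esym/eqP; rewrite mulrn_eq0 /= => /eqP //.
  rewrite /hterm size_rot Hw /= Hrot // !all_cat /= andbF.
  case: i => -[|i] Hi /=; first by rewrite !subr0 mulr1.
  by rewrite andbF !subr0 mulr1.
rewrite /pair_div -xpartE -ypartE at_ /xpart /ypart !Hrot // krv_depth1_left //.
case: i => -[|i] Hi /=.
  by rewrite ?subn0 cats1 -/w Hb !if_same addr0.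
rewrite if_same add0r; case: ifP => //.
have L x n : last x (nseq n.+1 false) = false by elim: n x => //= n IH x; apply: IH.
by rewrite last_cat /= -[last false _]/(last true (nseq i.+1 false)) L andbF.
Qed.

(** * The trace of the elliptic divergence *)

Lemma conj_exp z k : (ex * z * exN) ^+ k = ex * z ^+ k * exN.
Proof.
elim: k => [|k IH]; first by rewrite !expr0 mulr1 exNr.
by rewrite !exprS IH !mulrA -[_ * exN * ex]mulrA exNl mulr1.
Qed.

Lemma comm_summable c : summable (fun k => c k *: (sX * sY - sY * sX) ^+ k).
Proof.
move=> k; apply/vordZ/expr_ord; apply: (@vord_le _ 2) => //.
by apply: vordB; apply: (@vordM 1 1); apply: vord_smono.
Qed.

Lemma gamma_div_comm e : krv e -> exists c : nat -> rat,
  cyc (dR false (gamma e) + dR true (gamma_y e)) =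
  cyc (ssum (fun k => c k *: (sX * sY - sY * sX) ^+ k)).
Proof.
move=> He; have [h Hh] := krv_cyc He; exists (hcut h).
have [va vb] := krv_vord He.
rewrite gamma_div; [|exact: krv_sder|exact: va|exact: vb].
rewrite -saddE pair_divE (cyc_ell Hh) htermE.
rewrite (ssum_cont (@hterm_summable h) cont_ell (@slocal_subst _ _)).
have Hs : summable (fun k => ell_subst (hcut h k *: ((sX + sY) ^+ k - sX ^+ k - sY ^+ k))).
  by move=> k; apply: slocal_subst; apply: hterm_summable.
rewrite (ssum_cont Hs cont_cyc slocal_cyc).
rewrite (ssum_cont (@comm_summable (hcut h)) cont_cyc slocal_cyc); apply: eq_ssum => k.
have ellXn f : ell_subst (f ^+ k) = ell_subst f ^+ k by exact: (subst_exp px_nil py_nil).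
rewrite (cont_scale cont_ell) !(cont_sub cont_ell) !ellXn (cont_add cont_ell) ellX ellY px_py.
rewrite !(cont_scale cont_cyc); case: (boolP (odd k)) => ok; last first.
  by rewrite (krv_h_even He Hh) // !scale0r.
congr (_ *: _); rewrite -addrA -opprD (cont_sub cont_cyc) [X in _ - X](_ : _ = 0) ?subr0 //.
rewrite (cont_add cont_cyc) [X in _ + cyc X](_ : _ = - (ex * px ^+ k * exN)).
  by rewrite (cont_opp cont_cyc) cycM mulrA exNl mul1r subrr.
by rewrite /py exprNn -signr_odd ok expr1 mulN1r conj_exp.
Qed.

(** * Generating polynomials *)

Section GenPoly.
Variable A : comAlgType rat.
Implicit Types (z : nat -> A) (f g : series).

(* The word x^e0 y x^e1 y ... y x^er goes to z_0^e0 ... z_r^er. *)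
Fixpoint mon z (w : word) : A :=
  match w with
  | [::] => 1
  | false :: w' => z 0%N * mon z w'
  | true :: w' => mon (fun i => z i.+1) w'
  end.

(** Generating polynomial of the part of depth r and weight n. The z_i are left free: the
    coordinates u and v, the push and the cyclic shifts are all choices of z. *)
Definition gf r n z f : A :=
  \sum_(w <- words n) (if count id w == r then f w *: mon z w else 0).

Lemma eq_mon z z' w : (forall i, (i <= count id w)%N -> z i = z' i) -> mon z w = mon z' w.
Proof.
elim: w z z' => [|[] w IH] z z' H //=; first by apply: IH => i Hi; apply: H.
by rewrite H // (IH _ _ H).
Qed.

Lemma mon_rcons z w b : mon z (rcons w b) = if b then mon z w else mon z w * z (count id w).
Proof.
elim: w z => [|c w IH] z; first by case: b => //=; rewrite mulr1 mul1r.
by case: c => /=; rewrite IH; case: (b); rewrite ?mulrA.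
Qed.

Lemma eq_gf r n z z' f : (forall i, (i <= r)%N -> z i = z' i) -> gf r n z f = gf r n z' f.
Proof.
move=> H; apply: eq_bigr => w _; case: eqP => // Hw; congr (_ *: _).
by apply: eq_mon => i; rewrite Hw; apply: H.
Qed.

Lemma gfD r n z f g : gf r n z (f + g) = gf r n z f + gf r n z g.
Proof.
rewrite /gf -big_split; apply: eq_bigr => w _ /=.
by case: eqP; rewrite ?addr0 // at_ scalerDl.
Qed.
Lemma gfN r n z f : gf r n z (- f) = - gf r n z f.
Proof.
rewrite /gf -sumrN; apply: eq_bigr => w _.
by case: eqP; rewrite ?oppr0 // at_ scaleNr.
Qed.
Lemma gfB r n z f g : gf r n z (f - g) = gf r n z f - gf r n z g.
Proof. by rewrite gfD gfN. Qed.
Lemma gfZ r n z c f : gf r n z (c *: f) = c *: gf r n z f.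
Proof.
rewrite /gf scaler_sumr; apply: eq_bigr => w _.
by case: eqP; rewrite ?scaler0 // at_ scalerA.
Qed.

Lemma eq_in_gf r n z f g : (forall w, size w = n -> f w = g w) -> gf r n z f = gf r n z g.
Proof.
move=> H; rewrite /gf big_seq [RHS]big_seq; apply: eq_bigr => w /size_words Hw.
by rewrite H.
Qed.

Lemma gf_vord r n z f : vord n.+1 f -> gf r n z f = 0.
Proof.
move=> Hf; rewrite /gf big_seq big1 // => w /size_words Hw.
by rewrite Hf ?Hw // scale0r if_same.
Qed.

Lemma gf_X r n z f : gf r n.+1 z (sX * f) = z 0%N * gf r n z f.
Proof.
rewrite /gf big_wordsS mulr_sumr; apply: eq_bigr => w _; rewrite !sX_cons /= mul1r mul0r.
by rewrite scale0r if_same addr0; case: eqP; rewrite ?mulr0 // scalerAr.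
Qed.
Lemma gf_Y r n z f : gf r.+1 n.+1 z (sY * f) = gf r n (fun i => z i.+1) f.
Proof.
rewrite /gf big_wordsS; apply: eq_bigr => w _; rewrite !sY_cons /= mul1r mul0r.
by rewrite scale0r if_same add0r add1n eqSS.
Qed.
Lemma gf_Y0 n z f : gf 0 n z (sY * f) = 0.
Proof.
case: n => [|n]; first by rewrite gf_vord //; apply/vordMr/vord_smono.
rewrite /gf big_wordsS big1 // => w _; rewrite !sY_cons /= mul0r.
by rewrite scale0r if_same addr0.
Qed.
Lemma gfX r n z f : gf r n.+1 z (f * sX) = gf r n z f * z r.
Proof.
rewrite /gf big_wordsSr mulr_suml; apply: eq_bigr => w _.
rewrite !mul_letter /= mul1r mul0r scale0r if_same addr0 mon_rcons -cats1 count_cat /= !addn0.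
by case: eqP => [<-|_]; rewrite ?mul0r // scalerAl.
Qed.
Lemma gfY r n z f : gf r.+1 n.+1 z (f * sY) = gf r n z f.
Proof.
rewrite /gf big_wordsSr; apply: eq_bigr => w _.
by rewrite !mul_letter /= mul1r mul0r scale0r if_same add0r mon_rcons -cats1 count_cat /= addn1 eqSS.
Qed.

Lemma gf1 r z : gf r 0 z 1 = (r == 0%N)%:R.
Proof. by rewrite /gf big_words0 one_at eqxx scale1r /= eq_sym; case: eqP. Qed.

(** Each ad x in C_(i+1) multiplies by z_0 - z_1, the difference of the variables on the two sides
    of its y. *)
Lemma gf_sC r i n z g :
  gf r.+1 (i.+1 + n) z (sC i.+1 * g) = (z 0%N - z 1%N) ^+ i * gf r n (fun j => z j.+1) g.
Proof.
elim: i n g => [|i IH] n g; first by rewrite add1n gf_Y expr0 mul1r.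
rewrite sCS // /adx mulrBl gfB -!mulrA addSn gf_X IH -addnS IH gf_X exprS.
by rewrite [X in _ - X]mulrCA -mulrBl mulrA.
Qed.

Lemma gf_sC0 i n z g : gf 0 n z (sC i.+1 * g) = 0.
Proof.
elim: i n g => [|i IH] n g; first exact: gf_Y0.
case: n => [|n].
  rewrite gf_vord //; apply: vordMr; rewrite sCS //; apply: (@vord_le _ 1) => //.
  exact: (@vord_adx 0).
by rewrite sCS // /adx mulrBl gfB -!mulrA gf_X !IH mulr0 subr0.
Qed.

Lemma gf_Cprod r z a : all (leq 1) a ->
  gf r (sumn a) z (Cprod a) =
    if size a == r then \prod_(i < r) (z i - z i.+1) ^+ (nth 0%N a i).-1 else 0.
Proof.
elim: a r z => [|[|i] a IH] r z //= Ha.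
  by rewrite sOneE gf1; case: r => [|r] /=; rewrite ?big_ord0.
case: r => [|r]; first exact: gf_sC0.
rewrite smulE gf_sC IH // eqSS; case: eqP => _; last by rewrite mulr0.
by rewrite big_ord_recl; congr (_ * _); apply: eq_bigr => j _; rewrite lift0.
Qed.

(** [x, y] is C_2, so each factor contributes depth 1, weight 2 and one difference of consecutive
    variables. *)
Lemma gf_comm_exp r n k z :
  gf r n z ((sX * sY - sY * sX) ^+ k) =
    if (k == r) && (n == 2 * r)%N then \prod_(i < r) (z i - z i.+1) else 0.
Proof.
elim: k r n z => [|k IH] r n z.
  case: n => [|n]; last first.
    rewrite expr0 /gf big_seq big1 => [|w /size_words Hw].
      by case: r => [|r].
    by rewrite one_at; case: w Hw => // b w _; rewrite scale0r if_same.
  by rewrite expr0 gf1; case: r => [|r] //=; rewrite big_ord0.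
rewrite exprS -[sX * sY - sY * sX]/(sC 2); case: r => [|r]; first exact: gf_sC0.
have v2 : vord 2 (sC 2 * sC 2 ^+ k).
  by apply: vordMr; apply: (@vord_adx 1); apply: vord_smono.
case: n => [|[|n]]; [| |].
- by rewrite gf_vord ?mulnS ?andbF //; apply: vord_le v2.
- by rewrite gf_vord ?mulnS ?andbF.
rewrite -add2n gf_sC expr1 IH eqSS mulnS eqn_add2l.
by case: ifP => _; rewrite ?mulr0 // big_ord_recl.
Qed.

Lemma gf_ssum r n z F : summable F -> gf r n z (ssum F) = \sum_(k < n.+1) gf r n z (F k).
Proof.
move=> sF; rewrite (@eq_in_gf _ _ _ _ (\sum_(k < n.+1) F k)) => [|w Hw]; last first.
  by rewrite /ssum Hw sum_at.
by elim/big_rec2: _ => [|k y1 y2 _ <-]; rewrite ?gfD // -[0](scale0r 0) gfZ scale0r.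
Qed.

Lemma gf_comm_ssum r n z c :
  gf r n z (ssum (fun k => c k *: (sX * sY - sY * sX) ^+ k)) =
    if n == (2 * r)%N then c r *: \prod_(i < r) (z i - z i.+1) else 0.
Proof.
rewrite gf_ssum; last exact: comm_summable.
under eq_bigr => k _ do rewrite gfZ gf_comm_exp.
case: eqP => Hn; last by rewrite big1 // => k _; rewrite andbF scaler0.
have Hr : (r < n.+1)%N by lia.
rewrite (bigD1 (Ordinal Hr)) //= eqxx [X in _ + X]big1 ?addr0 // => k /eqP Hk.
by case: eqP => [E|]; [case: Hk; apply: val_inj|rewrite scaler0].
Qed.

(* The contributions of C cancel when z_(r+1) = z_0. *)
Lemma gf_push B C r n z : B * sY - sY * B + (sX * C - C * sX) = 0 -> z r.+1 = z 0%N ->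
  gf r n z B = gf r n (fun i => z i.+1) B.
Proof.
move=> H Hz; have := congr1 (gf r.+1 n.+1 z) H.
rewrite gfD !gfB gfY gf_Y gf_X gfX Hz [_ * z 0%N]mulrC subrr addr0.
have -> : gf r.+1 n.+1 z 0 = 0 by rewrite gf_vord.
by move/subr0_eq.
Qed.

(** With r-periodic variables, rotating a letter x fixes the monomial of a depth-r word, since z_r =
    z_0, and rotating a letter y shifts the variables by one. The sum over shifts thus depends only
    on the trace. *)
Lemma gf_cyc r n (Y : nat -> A) f g : (forall m, Y (m + r)%N = Y m) -> cyc f = cyc g ->
  \sum_(i < r) gf r n (fun m => Y (m + i.+1)%N) f =
  \sum_(i < r) gf r n (fun m => Y (m + i.+1)%N) g.
Proof.
move=> HY Hfg.
have H : cyc (f - g) = 0 by rewrite (cont_sub cont_cyc) Hfg subrr.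
apply/eqP; rewrite -subr_eq0 -sumrB; under eq_bigr => i _ do rewrite -gfB.
rewrite /gf exchange_big /=.
pose c w : A := if count id w == r then \sum_(i < r) mon (fun m => Y (m + i.+1)%N) w else 0.
rewrite (eq_bigr (fun w => (f - g) w *: c w)) => [|w _].
  apply/eqP/cyc_pairing => // w _; rewrite /c; case: w => [|b w] //.
  rewrite rot1_cons -cats1 count_cat /= addn0 addnC cats1; case: eqP => // Hw.
  case: b Hw => /= Hw.
    rewrite (eq_bigr (fun i : 'I_r => mon (fun m => Y (m + i.+1)%N) w)) => [|i _].
      case: r HY {H c} Hw => [|r] HY Hw; first by rewrite !big_ord0.
      rewrite big_ord_recl [RHS]big_ord_recr addrC /=; congr (_ + _).
        by apply: eq_bigr => i _; apply: eq_mon => m _; congr Y; rewrite /bump /=; lia.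
      by apply: eq_mon => m _; rewrite -[LHS]HY; congr Y; lia.
    by rewrite mon_rcons.
  rewrite add0n in Hw; apply: eq_bigr => i _; rewrite mon_rcons Hw mulrC; congr (_ * _).
  by rewrite -[in RHS]HY; congr Y; lia.
by rewrite /c; case: eqP => _; rewrite ?scaler0 ?scaler_sumr // big1.
Qed.
End GenPoly.

(** * Expansion on products of the C_i *)

Lemma mem_comps_aux m n a : (n <= m)%N ->
  (a \in comps_aux m n) = all (leq 1) a && (sumn a == n).
Proof.
have H0 (c : seq nat) : (c \in [:: [::]]) = all (leq 1) c && (sumn c == 0%N).
  by case: c => [|[|x] c]; rewrite // inE /= ?andbF.
elim: m n a => [|m IH] [|n] a // Hn; try exact: H0.
rewrite -[comps_aux _ _]/(flatten [seq [seq i :: s | s <- comps_aux m (n.+1 - i)] | i <- iota 1 n.+1]).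
apply/flatten_mapP/idP => [[i Hi /mapP[s Hs ->]]|].
  move: Hi Hs; rewrite mem_iota => Hi; rewrite IH; last by lia.
  by case/andP=> /= -> /eqP->; rewrite andbT; lia.
case: a => [|i a] /=; first by [].
case/andP=> /andP[Hi Ha] /eqP Hs.
have Hi' : i \in iota 1 n.+1 by rewrite mem_iota; lia.
have Ha' : a \in comps_aux m (n.+1 - i) by rewrite IH ?Ha /=; lia.
by exists i; [exact: Hi'|exact: (map_f _ Ha')].
Qed.

Lemma comps_aux_uniq m n : uniq (comps_aux m n).
Proof.
elim: m n => [|m IH] [|n] //.
rewrite -[comps_aux _ _]/[seq i :: s | i <- iota 1 n.+1, s <- comps_aux m (n.+1 - i)].
apply: allpairs_uniq_dep.
- exact: iota_uniq.
- by move=> i _; apply: IH.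
by move=> [i s] [j t] _ _ /= [-> ->].
Qed.

Lemma mem_comps n a : (a \in comps n) = all (leq 1) a && (sumn a == n).
Proof. exact: mem_comps_aux. Qed.

Lemma Cprod_hom a w : all (leq 1) a -> size w <> sumn a -> Cprod a w = 0.
Proof.
elim: a w => [|i a IH] w /=.
  by case: w => // b w _ _; rewrite sOneE one_at.
case/andP=> Hi Ha Hw; rewrite smulE mul_at big1 // => j _.
rewrite (sC_hom Hi) /hcomp; case: eqP => Hj; rewrite ?mul0r // IH ?mulr0 //.
by move=> Hd; case: Hw; rewrite -Hj -Hd -size_cat cat_take_drop.
Qed.

Lemma Cprod_cat a b : Cprod (a ++ b) = Cprod a * Cprod b.
Proof. by elim: a => [|i a IH] /=; rewrite ?mul1r // IH smulE mulrA. Qed.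

Definition Cspan (f : series) : Prop :=
  exists2 l : seq (rat * seq nat), all (fun x => all (leq 1) x.2) l &
    f = \sum_(x <- l) x.1 *: Cprod x.2.

Lemma CspanD f g : Cspan f -> Cspan g -> Cspan (f + g).
Proof.
move=> [l Hl ->] [l' Hl' ->]; exists (l ++ l'); first by rewrite all_cat Hl.
by rewrite big_cat.
Qed.
Lemma CspanZ c f : Cspan f -> Cspan (c *: f).
Proof.
move=> [l Hl ->]; exists [seq (c * x.1, x.2) | x <- l]; first by rewrite all_map.
by rewrite big_map scaler_sumr; apply: eq_bigr => x _; rewrite scalerA.
Qed.
Lemma CspanM f g : Cspan f -> Cspan g -> Cspan (f * g).
Proof.
move=> [l Hl ->] [l' Hl' ->].
exists [seq (x.1 * y.1, x.2 ++ y.2) | x <- l, y <- l'].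
  apply/allP => _ /allpairsP[[x y] /= [Hx Hy ->]] /=.
  by rewrite all_cat (allP Hl x Hx) (allP Hl' y Hy).
rewrite big_allpairs_dep mulr_suml; apply: eq_bigr => x _.
rewrite mulr_sumr; apply: eq_bigr => y _.
by rewrite Cprod_cat -scalerAl -scalerAr scalerA.
Qed.

Lemma lie_span_Cspan f : lie_span (fun g => exists i, (0 < i)%N /\ g = sC i) f -> Cspan f.
Proof.
elim=> [g [i [Hi ->]]|g h _ Hg _ Hh|c g _ Hg|g h _ Hg _ Hh].
- exists [:: (1, [:: i])]; first by rewrite /= Hi.
  by rewrite big_seq1 scale1r /= smulE sOneE mulr1.
- exact: CspanD.
- exact: CspanZ.
rewrite sbrE -scaleN1r; apply: CspanD; first exact: CspanM.
exact/CspanZ/CspanM.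
Qed.

Lemma lie_C_Cexp b : lie_C b -> exists k, Cexp k b.
Proof.
move=> Hb.
have H n : exists k : seq nat -> rat, forall w, size w = n ->
    b w = \sum_(a <- comps n) k a * Cprod a w.
  have [l Hl E] := lie_span_Cspan (Hb n).
  exists (fun a => \sum_(x <- l | x.2 == a) x.1) => w Hw.
  have -> : b w = hcomp n b w by rewrite /hcomp Hw eqxx.
  rewrite E sum_at; under [RHS]eq_bigr => a _ do rewrite mulr_suml big_mkcond.
  rewrite exchange_big big_seq [RHS]big_seq; apply: eq_bigr => x Hx /=.
  have Hx2 := allP Hl x Hx; rewrite at_.
  case: (boolP (x.2 \in comps n)) => Hc.
    rewrite (bigD1_seq x.2) ?comps_aux_uniq //= eqxx big1 ?addr0 // => a Ha.
    by rewrite eq_sym (negbTE Ha).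
  rewrite Cprod_hom // ?mulr0; last first.
    by move=> Hs; move: Hc; rewrite mem_comps Hx2 -Hs Hw eqxx.
  rewrite big_seq big1 // => a Ha; case: eqP => // E2.
  by rewrite E2 Ha in Hc.
(* Coefficients were chosen weight by weight; they are glued by reading the weight of [a] as
   [sumn a]. *)
have [K HK] := boolp.choice H.
exists (fun a => K (sumn a) a) => w; rewrite (HK _ w erefl) big_seq [RHS]big_seq.
by apply: eq_bigr => a; rewrite mem_comps => /andP[_ /eqP->].
Qed.

(** * Push-invariance and circ-neutrality *)

Section Compare.
Variables (k : seq nat -> rat) (b : series).
Hypothesis Hk : Cexp k b.

(** The dictionary u_i = z_(i-1) - z_i between B^r and the generating polynomial of [b], resting on
    [gf_Cprod]; the value no longer mentions [k]. *)
Lemma Bpoly_comp r s n (t : r.-tuple {mpoly rat[s]}) (z : nat -> {mpoly rat[s]}) :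
  (forall i : 'I_r, tnth t i = z i - z i.+1) -> Bpoly k r n \mPo t = gf r n z b.
Proof.
move=> Ht; rewrite (@eq_in_gf _ r n z b (\sum_(a <- comps n) k a *: Cprod a)); last first.
  by move=> w Hw; rewrite Hk sum_at Hw.
have gf_sum (l : seq (seq nat)) : gf r n z (\sum_(a <- l) k a *: Cprod a) =
    \sum_(a <- l) k a *: gf r n z (Cprod a).
  elim: l => [|a l IH]; rewrite ?big_nil ?big_cons; first by rewrite gf_vord.
  by rewrite gfD gfZ IH.
rewrite gf_sum /Bpoly (raddf_sum (comp_mpoly t)) big_mkcond big_seq [RHS]big_seq.
apply: eq_bigr => a; rewrite mem_comps => /andP[Ha /eqP <-].
rewrite gf_Cprod //; case: eqP => _; last by rewrite scaler0.
rewrite /= comp_mpolyZ rmorph_prod; congr (_ *: _); apply: eq_bigr => i _.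
by rewrite rmorphXn /= comp_mpolyXU -tnth_nth Ht.
Qed.
End Compare.

Lemma Dpoly_comp r s (t : r.-tuple {mpoly rat[s]}) (z : nat -> {mpoly rat[s]}) :
  (forall i : 'I_r, tnth t i = z i - z i.+1) ->
  Dpoly r \mPo t = (\prod_(i < r) (z i - z i.+1)) * (z 0%N - z r).
Proof.
move=> Ht; have Hx (i : 'I_r) : 'X_i \mPo t = z i - z i.+1 by rewrite comp_mpolyXU -tnth_nth.
rewrite /Dpoly rmorphM rmorph_prod (raddf_sum (comp_mpoly t)); congr (_ * _).
  by apply: eq_bigr => i _; exact: Hx.
rewrite (eq_bigr (fun i : 'I_r => z i - z i.+1)) => [|i _]; last exact: Hx.
rewrite -(big_mkord predT (fun i => z i - z i.+1)).
rewrite (@telescope_sumr_eq _ 0 r (fun i => - z i)) // => [|i _]; by rewrite opprK addrC.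
Qed.

Lemma mon_comp r s (t : r.-tuple {mpoly rat[s]}) (z : nat -> {mpoly rat[r]}) w :
  mon z w \mPo t = mon (fun i => z i \mPo t) w.
Proof.
elim: w z => [|[] w IH] z /=; first exact: comp_mpoly1.
  by rewrite IH.
by rewrite rmorphM /= IH.
Qed.

Lemma gf_comp r s (t : r.-tuple {mpoly rat[s]}) m n (z : nat -> {mpoly rat[r]}) f :
  gf m n z f \mPo t = gf m n (fun i => z i \mPo t) f.
Proof.
rewrite /gf (raddf_sum (comp_mpoly t)); apply: eq_bigr => w _.
by case: eqP => _ /=; rewrite ?comp_mpoly0 // comp_mpolyZ mon_comp.
Qed.

Lemma mvar_ord r j (Hj : (j < r)%N) : mvar r j = 'X_(Ordinal Hj).
Proof. by rewrite /mvar insubT. Qed.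

Lemma mvar_comp r s (t : r.-tuple {mpoly rat[s]}) j (Hj : (j < r)%N) :
  mvar r j \mPo t = tnth t (Ordinal Hj).
Proof. by rewrite mvar_ord comp_mpolyXU -tnth_nth. Qed.

Lemma mvar_neq0 r j : (j < r)%N -> mvar r j != 0.
Proof.
move=> Hj; rewrite mvar_ord; apply/eqP => /(congr1 (fun p : {mpoly rat[r]} => p@_U_(Ordinal Hj))).
by rewrite mcoeffXU eqxx mcoeff0 => /eqP; rewrite oner_eq0.
Qed.

Lemma mvar_inj r i j : (i < r)%N -> (j < r)%N -> mvar r i = mvar r j -> i = j.
Proof.
move=> Hi Hj; rewrite !mvar_ord => /(congr1 (fun p : {mpoly rat[r]} => p@_U_(Ordinal Hi))).
rewrite !mcoeffXU eqxx; case: eqP => [/(congr1 val)//|_] /eqP.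
by rewrite oner_eq0.
Qed.

Lemma push_of_assoc k B C : Cexp k B ->
  B * sY - sY * B + (sX * C - C * sX) = 0 -> push_invariant k.
Proof.
move=> Hk H r n Hr.
(* Here z_0 = 0 and z_i = u_i + ... + u_r, so z_(r+1) = 0 closes the cycle: u_i is z_i - z_(i+1),
   and the push replaces it by z_(i-1) - z_i. *)
pose z (m : nat) : {mpoly rat[r]} :=
  if m is i.+1 then \sum_(j < r | (i <= j)%N) 'X_j else 0.
have zr : z r.+1 = 0.
  by rewrite /z big1 // => j Hj; have := ltn_ord j; rewrite ltnNge Hj.
have z0 : z 0%N = 0 by [].
have dz (i : 'I_r) : z i.+1 - z i.+2 = 'X_i.
  rewrite /z (bigD1 i) //= [X in _ - X](eq_bigl (fun j : 'I_r => (i <= j)%N && (j != i))).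
    by rewrite addrK.
  by move=> j; rewrite ltn_neqAle andbC; congr (_ && _); rewrite eq_sym.
have Hid (i : 'I_r) : tnth [tuple 'X_i | i < r] i = z i.+1 - z i.+2 :> {mpoly rat[r]}.
  by rewrite tnth_mktuple dz.
have Hpush (i : 'I_r) : tnth (push_t r) i = z i - z i.+1.
  rewrite tnth_mktuple; case: i => -[|i] Hi /=; first by rewrite sub0r.
  by rewrite -[i]/(nat_of_ord (Ordinal (ltnW Hi))) dz mvar_ord; congr 'X_ _; apply: val_inj.
have EB : Bpoly k r n \mPo push_t r = Bpoly k r n.
  rewrite (Bpoly_comp Hk n Hpush) -[RHS]comp_mpoly_id.
  by rewrite (Bpoly_comp Hk n (z := fun i => z i.+1) Hid) (@gf_push _ B C r n z H zr).
(* Both sides are minus the product of the r + 1 cyclic differences of z_0, ..., z_r. *)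
have ED : Dpoly r \mPo push_t r = Dpoly r.
  rewrite (Dpoly_comp Hpush) -[RHS]comp_mpoly_id (Dpoly_comp (z := fun i => z i.+1) Hid) zr.
  clearbody z; case: r Hr z zr z0 dz Hid Hpush {EB} => // r _ z zr z0 dz Hid Hpush.
  rewrite big_ord_recl [in RHS]big_ord_recr /= zr z0.
  rewrite (eq_bigr (fun i : 'I_r => z i.+1 - z i.+2)) => [|i _]; last by [].
  by rewrite !sub0r !subr0 mulNr mulrN mulNr opprK; ring.
by rewrite EB ED.
Qed.

(** The coefficient of x w y in the equation shows that C_y is minus the left quotient of B by x, so
    the divergence involves B alone. Multiplying by Z_0 = Z_r completes both quotients to B, up to
    the words beginning, respectively ending, in y; these are isolated by putting 0 for the first or
    last variable. *)
Lemma gf_div (A : comAlgType rat) (B C : series) r n (Z : nat -> A) :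
  (0 < r)%N -> B [::] = 0 -> B * sY - sY * B + (sX * C - C * sX) = 0 -> Z r = Z 0%N ->
  Z 0%N * gf r n Z (dR false B + dR true C) =
    gf r n.+1 (fun m => if m is _.+1 then Z m else 0) B -
    gf r n.+1 (fun m => if m is m'.+1 then Z m' else 0) B.
Proof.
case: r => // r _ B0 H HZ.
have dC : dR true C = - lq false B.
  apply: sext => w; rewrite opp_at /dR /lq.
  have := congr1 (fun g : series => g (rcons (false :: w) true)) H.
  rewrite !at_ !mul_letter rcons_cons sX_cons sY_cons /=; lra.
have EL z : gf r.+1 n.+1 z B = z 0%N * gf r.+1 n z (lq false B) + gf r n (fun i => z i.+1) (lq true B).
  by rewrite {1}(lq_decomp B) B0 scale0r add0r gfD gf_X gf_Y.
have ER z : gf r.+1 n.+1 z B = gf r.+1 n z (dR false B) * z r.+1 + gf r n z (dR true B).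
  by rewrite {1}(part_decomp B0) gfD gfX gfY.
rewrite dC gfB mulrBr [Z 0%N * gf _ _ _ (lq _ _)](_ : _ =
   gf r.+1 n.+1 Z B - gf r n (fun i => Z i.+1) (lq true B)); last by rewrite EL addrK.
rewrite -{1}HZ mulrC [_ * Z r.+1](_ : _ = gf r.+1 n.+1 Z B - gf r n Z (dR true B)); last first.
  by rewrite ER addrK.
rewrite [in RHS]EL mul0r add0r.
(* The sequence 0, Z_0, ..., Z_r, 0 closes up, so [gf_push] exchanges its leading 0 for the final
   one, which selects the words ending in y. *)
pose Zp m : A := if m is m'.+1 then (if (m' <= r)%N then Z m' else 0) else 0.
rewrite [X in _ = _ - X](@eq_gf _ _ _ _ Zp); last by case=> //= m; rewrite ltnS => ->.
rewrite (@gf_push _ B C _ _ Zp H) ?ER /Zp ?ltnn //= mulr0 add0r.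
rewrite [X in _ = _ - X](@eq_gf _ _ _ _ Z) => [|i /= -> //].
by rewrite opprB addrC addrA subrK.
Qed.

Lemma shift_sum (V : zmodType) r (F : nat -> V) : F r = F 0%N ->
  \sum_(i < r) F i.+1 = \sum_(i < r) F i.
Proof.
case: r => [|r] H; first by rewrite !big_ord0.
by rewrite big_ord_recr big_ord_recl /= H addrC.
Qed.

Lemma shift_prod (L : comPzRingType) r (F : nat -> L) : (forall m, F (m + r)%N = F m) ->
  forall s, \prod_(i < r) F (i + s)%N = \prod_(i < r) F i.
Proof.
case: r => [|r] H; first by move=> s; rewrite !big_ord0.
elim=> [|s IH]; first by apply: eq_bigr => i _; rewrite addn0.
rewrite -IH big_ord_recr [RHS]big_ord_recl /= mulrC; congr (_ * _).
  by rewrite -[RHS]H; congr F; lia.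
by apply: eq_bigr => i _; congr F; rewrite /bump /=; lia.
Qed.

(** Let P be the cyclic product of the y_m - y_(m+1). The denominator at s is P y_s y_(s+1) / (y_s -
    y_(s+1)), with inverse (1/y_(s+1) - 1/y_s) / P; summation by parts moves the difference to W,
    where it equals y G. *)
Lemma cyclic_residues (L : fieldType) r (y W G : nat -> L) :
  (0 < r)%N -> (forall m, y (m + r)%N = y m) -> (forall m, y m != 0) ->
  (forall m, y m - y m.+1 != 0) -> W r = W 0%N ->
  (forall s, y s.+1 * G s.+1 = W s.+1 - W s) ->
  let z s m := if m is _.+1 then y (m + s)%N else 0 in
  \sum_(i < r) W i.+1 / ((\prod_(m < r) (z i.+1 m - z i.+1 m.+1)) * (z i.+1 0%N - z i.+1 r)) =
  - (\sum_(i < r) G i.+1) / \prod_(m < r) (y m - y m.+1).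
Proof.
move=> r0 Hy y0 dy HW HG z; case: r r0 Hy HW @z => // r _ Hy HW z.
set P := \prod_(m < r.+1) (y m - y m.+1).
have HP s : P = \prod_(m < r) (y (m.+1 + s)%N - y (m.+2 + s)%N) * (y s - y s.+1).
  rewrite /P -(@shift_prod L r.+1 (fun m => y m - y m.+1) _ s.+1).
    rewrite big_ord_recr /=; congr (_ * _).
      by apply: eq_bigr => m _; congr (y _ - y _); lia.
    by congr (_ - _); rewrite -[RHS]Hy; congr y; lia.
  by move=> m; rewrite -addSn !Hy.
have HT s : W s / ((\prod_(m < r.+1) (z s m - z s m.+1)) * (z s 0%N - z s r.+1)) =
    W s * ((y s.+1)^-1 - (y s)^-1) / P.
  rewrite big_ord_recl /= add1n !sub0r [y (r.+1 + s)%N](_ : _ = y s); last by rewrite addnC.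
  rewrite (HP s) [X in _ * X * _](_ : _ = \prod_(m < r) (y (m.+1 + s)%N - y (m.+2 + s)%N)) //.
  have Q0 : \prod_(m < r) (y (m.+1 + s)%N - y (m.+2 + s)%N) != 0.
    by apply/prodf_neq0 => m _; rewrite addSn.
  by field; rewrite Q0 !oppr_eq0 !y0 dy.
under eq_bigr => i _ do rewrite HT.
rewrite -mulr_suml; congr (_ / _).
have HGs s : G s.+1 = W s.+1 / y s.+1 - W s / y s.+1.
  by rewrite -mulrBl -HG mulrAC divff ?mul1r.
under eq_bigr => i _ do rewrite mulrBr; rewrite sumrB.
under [in RHS]eq_bigr => i _ do rewrite HGs; rewrite sumrB opprB; congr (_ - _).
rewrite (@shift_sum L r.+1 (fun i => W i / y i.+1)) //.
by rewrite HW -[r.+1]add0n -addSn Hy.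
Qed.

(** The variable - v_(r-t+1), index modulo r. The swap amounts to z_0 = 0 and z_m = - v_(r-m+1),
    whence the sign and the reversed order. *)
Definition cyc_var r (t : nat) : {mpoly rat[r]} := - mvar r ((r - t %% r) %% r).

Lemma cyc_var_period r m : cyc_var r (m + r) = cyc_var r m.
Proof. by rewrite /cyc_var modnDr. Qed.

Lemma cyc_var_neq0 r m : (0 < r)%N -> cyc_var r m != 0.
Proof. by move=> Hr; rewrite oppr_eq0 mvar_neq0 // ltn_mod. Qed.

Lemma cyc_var_diff r m : (1 < r)%N -> cyc_var r m - cyc_var r m.+1 != 0.
Proof.
move=> Hr; have r0 : (0 < r)%N by exact: ltnW.
rewrite subr_eq0; apply/eqP => /oppr_inj/mvar_inj; rewrite !ltn_mod => /(_ r0 r0).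
have -> : (m.+1 %% r = (m %% r).+1 %% r)%N by rewrite -addn1 -modnDml addn1.
move: (m %% r)%N (ltn_pmod m r0) => a Ha; case: (a.+1 =P r) => Er.
  by rewrite -Er modnn subn0 modnn subSnn modn_small //; lia.
have Ha1 : (a.+1 < r)%N by lia.
rewrite (modn_small Ha1) (@modn_small (r - a.+1)); last by lia.
case: a Ha {Er Ha1} => [|a] Ha; first by rewrite subn0 modnn; lia.
by rewrite modn_small; lia.
Qed.

Lemma gamma_circ e k : krv e -> Cexp k (gamma e) -> swap_circ_neutral_mod_const k.
Proof.
move=> He Hk; have [c Hc] := gamma_div_comm He; exists c => r n Hr.
have r0 : (0 < r)%N by exact: ltnW.
(* In weight 0 only the empty composition exists, of depth 0 and not r. *)
case: n => [|n].
  rewrite big1 // => i _; rewrite /Bpoly /comps /= big_cons big_nil /=.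
  have -> : (0 == r)%N = false by case: r Hr {r0 i}.
  by rewrite !comp_mpoly0 /frac tofrac0 mul0r add0r.
set B := gamma e in Hk Hc; set C := gamma_y e in Hc.
pose io : {mpoly rat[r]} -> {fraction {mpoly rat[r]}} := @tofrac _.
pose z (s m : nat) : {mpoly rat[r]} := if m is _.+1 then cyc_var r (m + s) else 0.
pose W s := io (gf r n.+1 (z s) B).
pose G s := io (gf r n (fun m => cyc_var r (m + s)) (dR false B + dR true C)).
pose y t := io (cyc_var r t).
pose zs m : {mpoly rat[r]} := if m is m'.+1 then - mvar r (r - m) else 0.
have Hswap (i : 'I_r) : tnth (swap_t r) i = zs i - zs i.+1.
  rewrite tnth_mktuple; case: i => -[|i] Hi /=; first by rewrite sub0r opprK subn1.
  by rewrite opprK addrC -subn1 -subnDA add1n.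
(* Raising the index of v lowers that of [cyc_var]; [rev_ord] turns the rotation into a shift by i +
   1. *)
have Hcirc (i : 'I_r) m : (m <= r)%N -> zs m \mPo circ_t r (rev_ord i) = z i.+1 m.
  case: m => [|m] Hm /=; first exact: comp_mpoly0.
  rewrite comp_mpolyN /cyc_var; congr (- _).
  have Hm' : (r - m.+1 < r)%N by lia.
  rewrite (mvar_comp _ Hm') tnth_mktuple /=; congr mvar.
  have Hi := ltn_ord i.
  have -> : (r - m.+1 + (r - i.+1) = r + r - (m.+1 + i.+1))%N by lia.
  have : (m.+1 + i.+1 <= r + r)%N by lia.
  move: (m.+1 + i.+1)%N => t Ht; case: (ltnP t r) => Htr.
    by rewrite (modn_small Htr) -addnBA 1?ltnW // modnDl.
  have -> : (r + r - t = r - (t - r))%N by lia.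
  have -> : (t %% r = (t - r) %% r)%N by rewrite -{1}(subnK Htr) modnDr.
  case: (t - r =P r)%N => [->|Hn]; first by rewrite modnn subn0 modnn subnn mod0n.
  by rewrite (@modn_small (t - r)) //; lia.
have Hterm (i : 'I_r) :
    frac ((Bpoly k r n.+1 \mPo swap_t r) \mPo circ_t r (rev_ord i)) /
    frac ((Dpoly r \mPo swap_t r) \mPo circ_t r (rev_ord i)) =
    W i.+1 / ((\prod_(m < r) (io (z i.+1 m) - io (z i.+1 m.+1))) * (io (z i.+1 0%N) - io (z i.+1 r))).
  congr (_ / _).
    rewrite (Bpoly_comp Hk n.+1 Hswap) gf_comp /W /frac /io; congr tofrac.
    by apply: eq_gf => m Hm; apply: Hcirc.
  rewrite (Dpoly_comp Hswap) rmorphM rmorph_prod rmorphB /= !Hcirc //.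
  rewrite /frac tofracM tofracB /io; congr (_ * _); last by rewrite comp_mpoly0.
  rewrite rmorph_prod; apply: eq_bigr => m _.
  have Hm := ltn_ord m.
  by rewrite rmorphB /= (Hcirc i _ (ltnW Hm)) (Hcirc i _ Hm) tofracB.
have HY (m : nat) : cyc_var r (m + r) = cyc_var r m by exact: cyc_var_period.
have HG s : y s.+1 * G s.+1 = W s.+1 - W s.
  rewrite /y /G /W /io -tofracM -tofracB; congr tofrac.
  have B0 : B [::] = 0 by exact/gamma_nil/krv_sder.
  have := @gf_div _ B C r n (fun m => cyc_var r (m + s.+1)) r0 B0 (assoc_eq (krv_sder He)).
  rewrite add0n => ->; last by rewrite addnC HY.
  by congr (_ - _); apply: eq_gf => -[|m] //= _; rewrite ?addSnnS.
rewrite (reindex_inj (@rev_ord_inj r)) /= big_split /=.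
rewrite (eq_bigr _ (fun i _ => Hterm i)).
have ioz (s m : nat) : io (z s m) = if m is _.+1 then y (m + s)%N else 0.
  by case: m => //=; rewrite /io tofrac0.
(* The sum depends only on the trace, so the divergence may be replaced by the series in [x, y],
   whose r shifts all give c_r times the same cyclic product. *)
have HP : \sum_(i < r) G i.+1 = io (if n == (2 * r)%N then c r else 0)%:MP *
    (\prod_(m < r) (y m - y m.+1)) *+ r.
  have -> : \sum_(i < r) G i.+1 =
      io (\sum_(i < r) gf r n (fun m => cyc_var r (m + i.+1)) (dR false B + dR true C)).
    by rewrite /io rmorph_sum.
  rewrite (gf_cyc n HY Hc); under eq_bigr => i _ do rewrite gf_comm_ssum.
  rewrite (eq_bigr (fun=> (if n == (2 * r)%N then c r else 0)%:MP *
      \prod_(m < r) (cyc_var r m - cyc_var r m.+1))) => [|i _]; last first.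
    case: ifP => _; last by rewrite mpolyC0 mul0r.
    rewrite mul_mpolyC; congr (_ *: _).
    rewrite -(@shift_prod _ r (fun m => cyc_var r m - cyc_var r m.+1) _ i.+1) //.
    by move=> m; rewrite -addSn !HY.
  rewrite sumr_const card_ord /io rmorphMn /= tofracM rmorph_prod; congr (_ * _ *+ _).
  by apply: eq_bigr => m _; rewrite rmorphB.
rewrite (eq_bigr (fun i : 'I_r => W i.+1 / ((\prod_(m < r) ((if (m : nat) is _.+1 then y (m + i.+1)%N else 0) - y (m.+1 + i.+1)%N)) * (0 - (if r is _.+1 then y (r + i.+1)%N else 0))))) => [|i _]; last first.
  by rewrite !ioz; under [in LHS]eq_bigr => m _ do rewrite !ioz.
rewrite (@cyclic_residues _ r y W G) //.
(* What remains is - r c_r, cancelled by the r copies of the added constant. *)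
- rewrite HP sumr_const card_ord -mulrnAl -mulNr mulrK; last first.
    rewrite unitfE; apply/prodf_neq0 => m _.
    by rewrite /y /io -tofracB tofrac_eq0 cyc_var_diff.
  by rewrite eqSS /frac /io addNr.
- by move=> m; rewrite /y HY.
- by move=> m; rewrite /y /io tofrac_eq0 cyc_var_neq0.
- by move=> m; rewrite /y /io -tofracB tofrac_eq0 cyc_var_diff.
rewrite /W; congr io; apply: eq_gf => -[|m] //= _.
by rewrite addn0 HY.
Qed.

(** * The morphism *)

Lemma gamma_krv_ell e : krv e -> krv_ell (gamma e).
Proof.
move=> He; have He' := krv_sder He; split; first exact: lie_C_gamma.
have [k Hk] := lie_C_Cexp (lie_C_gamma He'); exists k; split=> //; split.
  exact: push_of_assoc Hk (assoc_eq He').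
exact: gamma_circ He Hk.
Qed.

Lemma sder2_linear c e e' : sder2 e -> sder2 e' -> sder2 (padd (pscale c e) e').
Proof.
move=> [Ha [Hb [a1 [b1 H]]]] [Ha' [Hb' [a1' [b1' H']]]].
split; first exact: (LCD (G := genXY) (LCZ c Ha) Ha').
split; first exact: (LCD (G := genXY) (LCZ c Hb) Hb').
split; first by rewrite /= saddE sscaleE !at_ a1 a1' mulr0 addr0.
split; first by rewrite /= saddE sscaleE !at_ b1 b1' mulr0 addr0.
have -> : szero = c *: (sadd (sbr sX e.1) (sbr sY e.2)) + sadd (sbr sX e'.1) (sbr sY e'.2).
  by rewrite H H' szeroE scaler0 addr0.
rewrite /= !saddE !sscaleE !sbrE !mulrDr !mulrDl -!scalerAr -!scalerAl.
by apply: sext => w; rewrite !at_; ring.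
Qed.

Lemma gamma_inj e e' : krv e -> krv e' -> gamma e = gamma e' -> e = e'.
Proof.
move=> /krv_sder He /krv_sder He' H.
have [] := gamma_inj0 (sder2_linear (-1) He' He).
  by rewrite gamma_linear H scaleN1r addNr.
rewrite /= !saddE !sscaleE !scaleN1r ![- _ + _]addrC => /subr0_eq H1 /subr0_eq H2.
by case: e e' H1 H2 {He He' H} => [a b] [a' b'] /= -> ->.
Qed.

(** The bracket of [krv] is given through the action of [e''] as a commutator. Since
    [ell_bracket_is] ranges over all companions of the two images, the clause on [assoc_a] records
    that companions exist. *)
Theorem theorem7 :
  exists g : series * series -> series,
    (forall e, krv e -> krv_ell (g e)) /\
    (forall e e', krv e -> krv e' -> g e = g e' -> e = e') /\
    (forall (c : rat) e e', krv e -> krv e' ->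
        g (padd (pscale c e) e') = sadd (sscale c (g e)) (g e')) /\
    (forall e, krv e -> exists a, assoc_a (g e) a) /\
    (forall e e', krv e -> krv e' ->
        exists e'', krv e'' /\
          (forall f, Eop e'' f = ssub (Eop e (Eop e' f)) (Eop e' (Eop e f))) /\
          ell_bracket_is (g e) (g e') (g e'')).
Proof.
exists gamma; split; first exact: gamma_krv_ell.
split; first exact: gamma_inj.
split; first by move=> c e e' _ _; apply: gamma_linear.
split; first by move=> e /krv_sder He; exists (gamma_y e); apply: gamma_assoc.
move=> e e' He He'; exists (sder_br e e'); split; first exact: krv_br.
split; first exact: Eop_br.
move=> a a' Ha Ha'; have [Se Se'] := (krv_sder He, krv_sder He').
rewrite -(assoc_unique (lie_C_gamma Se) (gamma_assoc Se) Ha).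
rewrite -(assoc_unique (lie_C_gamma Se') (gamma_assoc Se') Ha').
exact: gamma_br.
Qed.
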